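(* Let $\mathbb A$ be a Weil algebra of nilpotency index $N$, and let $U\subset\mathbb R^p$ and $V\subset\mathbb R^q$ be open. Then: (i) for $f,h\in C^N(U,\mathbb R)$, $J_{\mathbb A}(f+h)=J_{\mathbb A}f+J_{\mathbb A}h$ and $J_{\mathbb A}(fh)=(J_{\mathbb A}f)(J_{\mathbb A}h)$; (ii) if, in addition, $f(x)\neq0$ on $U$, then $J_{\mathbb A}(f^{-1})=(J_{\mathbb A}f)^{-1}$; (iii) if $f\in C^N(U,\mathbb R^q)$, $f(U)\subset V$, and $g\in C^N(V,\mathbb R^r)$, then, for every $X\in U^{\mathbb A}$, $$J_{\mathbb A}(g\circ f)(X)=(J_{\mathbb A}g)\bigl((J_{\mathbb A}f)(X)\bigr).$$ For vector- and matrix-valued maps, these statements hold componentwise, with every product formed in the indicated finite-dimensional associative algebra.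
   Context: A Weil algebra is a finite-dimensional, commutative, associative real algebra with unit of the form $\mathbb A=\mathbb R 1_{\mathbb A}\oplus\mathfrak m$, where $\mathfrak m$ is the unique maximal ideal and $\mathfrak m^{N+1}=0$, $\mathfrak m^N\neq 0$; $N$ is its nilpotency index. The scalar-part projection $\pi:\mathbb A\to\mathbb R$ is the canonical algebra morphism with kernel $\mathfrak m$; it acts componentwise on $\mathbb A^p$. For $U\subset\mathbb R^p$ open, $U^{\mathbb A}=\{X\in\mathbb A^p:\pi(X)\in U\}$. Finite Weil prolongation: for $f\in C^N(U,\mathbb R^q)$, $x\in U$, $H=(H_1,\dots,H_p)\in\mathfrak m^p$ (the $p$-fold Cartesian product of $\mathfrak m$), $$(J_{\mathbb A}f)(x+H)=\sum_{|\alpha|\le N}\frac1{\alpha!}(\partial^\alpha f)(x)H^\alpha\in\mathbb A^q .$$ In (ii), $f^{-1}$ denotes the reciprocal $1/f$ and $(J_{\mathbb A}f)^{-1}$ the pointwise inverse in $\mathbb A$. In (iii), $(J_{\mathbb A}f)(X)\in V^{\mathbb A}$ is automatic, since $\pi((J_{\mathbb A}f)(X))=f(\pi(X))\in V$. *)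

(* Defs.v *)
From HB Require Import structures.
From mathcomp Require Import all_boot all_order all_algebra all_field.
From mathcomp Require Import all_classical all_reals all_analysis.

Set Implicit Arguments.
Unset Strict Implicit.
Unset Printing Implicit Defensive.

Import GRing.Theory numFieldNormedType.Exports.

Local Open Scope classical_set_scope.
Local Open Scope ring_scope.

Definition alg_ideal (A : comPzRingType) (I : set A) : Prop :=
  [/\ I 0, (forall x y, I x -> I y -> I (x + y)) &
      (forall a x, I x -> I (a * x))].

Definition alg_maximal_ideal (A : comPzRingType) (I : set A) : Prop :=
  [/\ alg_ideal I, I <> setT &
      forall J : set A, alg_ideal J -> I `<=` J -> J <> setT -> J = I].

                                                                                
                                                                                
                                                                                
HB.mixin Record isWeil (R : realType) A of GRing.ComUnitAlgebra R A := {
  weil_max : set A;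
  weil_index : nat;
  weil_findim : exists (n : nat) (e : 'I_n -> A), forall a : A,
    exists c : 'I_n -> R, a = \sum_i c i *: e i;
  weil_decomp : forall a : A, exists (r : R) (h : A),
    weil_max h /\ a = r%:A + h;
  weil_direct : forall r : R, weil_max r%:A -> r = 0;
  weil_maximal : alg_maximal_ideal weil_max;
  weil_unique : forall I : set A, alg_maximal_ideal I -> I = weil_max;
  weil_nilp : forall h : 'I_weil_index.+1 -> A,
    (forall i, weil_max (h i)) -> \prod_i h i = 0;
  weil_nilp_min : exists h : 'I_weil_index -> A,
    (forall i, weil_max (h i)) /\ \prod_i h i <> 0
}.

#[short(type="weilType")]
HB.structure Definition Weil (R : realType) :=
  { A of GRing.ComUnitAlgebra R A & isWeil R A }.

Arguments weil_max {R} s.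
Arguments weil_index {R} s.

Section Prolongation.
Variables (R : realType) (A : weilType R).

                                                                                
Definition weil_pi (a : A) : R :=
  xget 0 [set r : R | weil_max A (a - r%:A)].

Definition weil_dom (p : nat) (U : set 'rV[R]_p) : set 'rV[A]_p :=
  [set X | U (map_mx weil_pi X)].

Definition partial (p : nat) (i : 'I_p) (f : 'rV[R]_p -> R) : 'rV[R]_p -> R :=
  fun x => 'D_(delta_mx 0 i) f x.

                                                                                
                                                                                
Fixpoint classC (n p : nat) (U : set 'rV[R]_p) (f : 'rV[R]_p -> R) : Prop :=
  (forall x, U x -> {for x, continuous f}) /\
  (if n is n'.+1 then
     forall i : 'I_p, (forall x, U x -> derivable f x (delta_mx 0 i)) /\
                      classC n' U (partial i f)
   else True).

Definition classC_mx (n p : nat) (U : set 'rV[R]_p) (k l : nat)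
    (F : 'rV[R]_p -> 'M[R]_(k, l)) : Prop :=
  forall i j, classC n U (fun x => F x i j).

                                                                                
                                                                                
Definition mpartial (p : nat) (alpha : 'I_p -> nat) (f : 'rV[R]_p -> R) :
    'rV[R]_p -> R :=
  foldr (fun i g => iter (alpha i) (partial i) g) f (enum 'I_p).

Definition weilJ (p : nat) (f : 'rV[R]_p -> R) (X : 'rV[A]_p) : A :=
  let x : 'rV[R]_p := map_mx weil_pi X in
  let H : 'rV[A]_p := X - map_mx (fun r : R => r%:A) x in
  \sum_(alpha : {ffun 'I_p -> 'I_(weil_index A).+1}
        | (\sum_i alpha i <= weil_index A)%N)
    ((\prod_i (alpha i)`!)%:R^-1 * mpartial (fun i => alpha i) f x)
      *: \prod_i H 0 i ^+ alpha i.

                                                                                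
Definition weilJ_mx (p k l : nat) (F : 'rV[R]_p -> 'M[R]_(k, l))
    (X : 'rV[A]_p) : 'M[A]_(k, l) :=
  \matrix_(i, j) weilJ (fun x => F x i j) X.

                                                                                
                                                                                
                                                                                
Definition alg_coord (B : falgType R) (n : nat) (e : n.-tuple B) (b : B) :
    'rV[R]_n := \row_i coord e i b.

Definition alg_mul (B : falgType R) (n : nat) (e : n.-tuple B)
    (a b : 'rV[A]_n) : 'rV[A]_n :=
  \row_k \sum_i \sum_j coord e k (tnth e i * tnth e j) *: (a 0 i * b 0 j).

Definition alg_one (B : falgType R) (n : nat) (e : n.-tuple B) : 'rV[A]_n :=
  \row_k (coord e k 1)%:A.

End Prolongation.

(* Main.v *)
(* Fix X = x + H with H in m^p.  Over any commutative R-algebra S and increments K_i in S,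
   put D_0 f = f(x), D_(k+1) f = \sum_i K_i D_k (d_i f), and T_n f = \sum_(k <= n) D_k f / k!;
   since partial derivatives commute (Schwarz), T_N f with K = H is the Weil prolongation.
   Take S = A[t] and K_i of zero constant term.  Then (T_(n+1) f)' = \sum_j K_j' T_n (d_j f),
   so the product rule and the chain rule, fed into an induction on n that compares
   t-derivatives and constant terms, give T_n (f h) = T_n f * T_n h and
   T_n (g o f) = T_n g (T_n f - f(x)) modulo t^(n+1).  For K_i = H_i t the coefficient of t^k on
   both sides lies in m^k, which vanishes for k > N; hence at n = N these congruences are
   equalities, and t = 1 gives the multiplicativity and functoriality of the prolongation.
   The statements on inverses follow from multiplicativity, the inverse being of class C^N by
   Cramer's rule (applied to left multiplication in the case of an algebra). *)
Require Import Defs.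
From HB Require Import structures.
From mathcomp Require Import all_boot all_order all_algebra all_field.
From mathcomp Require Import all_classical all_reals all_analysis.
From mathcomp Require Import ring.

Set Implicit Arguments.
Unset Strict Implicit.
Unset Printing Implicit Defensive.

Import Order.TTheory GRing.Theory Num.Theory numFieldNormedType.Exports.

Local Open Scope classical_set_scope.
Local Open Scope ring_scope.

(** * Mean value theorem along lines and symmetry of mixed directional derivatives *)

Section Directional.
Variables (R : realType) (E : normedModType R).
Implicit Types (f : E -> R) (a u v x : E).

Lemma is_derive_line f a u (s : R) : derivable f (a + s *: u) u ->
  is_derive s 1 (fun t : R => f (a + t *: u)) ('D_u f (a + s *: u)).
Proof.
have E1 : (fun h : R => h^-1 *: (((fun t : R => f (a + t *: u)) \o shift s) (h *: 1)
      - f (a + s *: u))) =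
    (fun h : R => h^-1 *: ((f \o shift (a + s *: u)) (h *: u) - f (a + s *: u))).
  apply/funext => h /=; congr (_ *: (f _ - _)).
  by rewrite [h *: 1]mulr1 scalerDl addrCA.
move=> df; apply: DeriveDef; first by rewrite /derivable E1.
by rewrite /derive E1.
Qed.

Lemma MVT_line f a u (h : R) :
  (forall c : R, `|c| <= `|h| -> derivable f (a + c *: u) u) ->
  exists2 c : R, `|c| <= `|h| & f (a + h *: u) - f a = 'D_u f (a + c *: u) * h.
Proof.
move=> df; pose phi (t : R) := f (a + t *: u).
have dphi (c : R) : `|c| <= `|h| -> is_derive c 1 phi ('D_u f (a + c *: u)).
  by move=> /df; exact: is_derive_line.
have cphi (i : interval R) : {in i, forall c, `|c| <= `|h|} ->
    {within [set` i], continuous phi}.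
  by move=> ih; apply: derivable_within_continuous => c /ih /dphi [].
have phi0 : phi 0 = f a by rewrite /phi scale0r addr0.
have [h0|/ltW h0] := leP 0 h.
  have ih : forall c : R, c \in `[0, h]%R -> `|c| <= `|h|.
    by move=> c; rewrite in_itv /= => /andP[c0 ch]; rewrite !ger0_norm.
  have [||c /ih ch] := @MVT_segment _ phi (fun c => 'D_u f (a + c *: u)) _ _ h0.
  - move=> c; rewrite in_itv /= => /andP[c0 ch]; apply: dphi; apply: ih.
    by rewrite in_itv /= !ltW.
  - exact: cphi.
  by rewrite phi0 subr0 => ?; exists c.
have ih : forall c : R, c \in `[h, 0]%R -> `|c| <= `|h|.
  by move=> c; rewrite in_itv /= => /andP[c0 ch]; rewrite !ler0_norm // lerN2.
have [||c /ih ch] := @MVT_segment _ phi (fun c => 'D_u f (a + c *: u)) _ _ h0.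
- move=> c; rewrite in_itv /= => /andP[c0 ch]; apply: dphi; apply: ih.
  by rewrite in_itv /= !ltW.
- exact: cphi.
rewrite phi0 sub0r mulrN => eq1; exists c => //.
by rewrite -[LHS]opprB; apply/eqP; rewrite eqr_oppLR -eq1.
Qed.

(** Two applications of the mean value theorem: in direction u to z |-> f (z + h v) - f z, then in
    direction v to the derivative of f along u. The bound on h keeps every intermediate point in the
    ball of radius r. *)
Lemma second_difference f u v x (r h : R) : 0 <= h -> h * (`|u| + `|v|) < r ->
  (forall y, `|y - x| < r -> derivable f y u /\ derivable (fun z => 'D_u f z) y v) ->
  exists s t : R, [/\ `|s| <= h, `|t| <= h &
    (f (x + h *: u + h *: v) - f (x + h *: u)) - (f (x + h *: v) - f x) =
      h * h * 'D_v (fun z => 'D_u f z) (x + s *: u + t *: v)].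
Proof.
move=> h0 hr df.
have near_x (s t : R) : `|s| <= h -> `|t| <= h -> `|x + s *: u + t *: v - x| < r.
  move=> sh th; rewrite -(addrA x) [x + _]addrC addrK (le_lt_trans _ hr) //.
  rewrite (le_trans (ler_normD _ _)) // !normrZ mulrDr.
  by rewrite lerD // ler_wpM2r.
have near_x0 (s : R) : `|s| <= h -> `|x + s *: u - x| < r.
  by move=> sh; have := near_x s 0 sh; rewrite normr0 scale0r addr0; apply.
have derfv (s t : R) : `|s| <= h -> `|t| <= h ->
    is_derive (x + s *: u) u (fun z => f (z + t *: v)) ('D_u f (x + s *: u + t *: v)).
  move=> sh th; have [d1 _] := df _ (near_x s t sh th).
  have E1 : (fun k : R => k^-1 *: (((fun z => f (z + t *: v)) \o shift (x + s *: u)) (k *: u)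
      - f (x + s *: u + t *: v))) =
    (fun k : R => k^-1 *: ((f \o shift (x + s *: u + t *: v)) (k *: u)
      - f (x + s *: u + t *: v))).
    by apply/funext => k /=; rewrite !addrA.
  by apply: DeriveDef; rewrite ?/derivable ?/derive E1.
have hh : `|h| = h by rewrite ger0_norm.
pose phi z := f (z + h *: v) - f z.
have dphi (s : R) : `|s| <= h -> is_derive (x + s *: u) u phi
    ('D_u f (x + s *: u + h *: v) - 'D_u f (x + s *: u)).
  move=> sh; apply: is_deriveB; first by apply: derfv; rewrite ?hh.
  by apply/derivableP; exact: (df _ (near_x0 s sh)).1.
have [|s] := @MVT_line phi x u h.
  by move=> c; rewrite hh => /dphi [].
rewrite hh => sh; have [_ ->] := dphi s sh => eq1.
have [|t] := @MVT_line (fun z => 'D_u f z) (x + s *: u) v h.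
  by move=> c; rewrite hh => ch; exact: (df _ (near_x s c sh ch)).2.
rewrite hh => th eq2; exists s, t; split => //.
have {eq1 eq2} : phi (x + h *: u) - phi x =
    'D_v (fun z => 'D_u f z) (x + s *: u + t *: v) * h * h by rewrite eq1 eq2.
by rewrite /phi => ->; ring.
Qed.

(** Schwarz's theorem: the second difference is symmetric in u and v, so the two mixed derivatives
    agree at two points arbitrarily close to x, and continuity at x carries the equality over to
    x. *)
Lemma derive_swap f u v x :
  (\forall y \near x, [/\ derivable f y u, derivable f y v,
     derivable (fun z => 'D_u f z) y v & derivable (fun z => 'D_v f z) y u]) ->
  {for x, continuous (fun z => 'D_v (fun z => 'D_u f z) z)} ->
  {for x, continuous (fun z => 'D_u (fun z => 'D_v f z) z)} ->
  'D_v (fun z => 'D_u f z) x = 'D_u (fun z => 'D_v f z) x.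
Proof.
move=> df.
move=> cF cG.
(* F and G are opaque names for the mixed derivatives: unification cannot unfold them into
   limits. *)
have [F FE] : exists F : E -> R, (fun z => 'D_v (fun z => 'D_u f z) z) = F.
  by eexists.
have [G GE] : exists G : E -> R, (fun z => 'D_u (fun z => 'D_v f z) z) = G.
  by eexists.
rewrite FE in cF; rewrite GE in cG.
have {}FE z : 'D_v (fun z => 'D_u f z) z = F z by rewrite -FE.
have {}GE z : 'D_u (fun z => 'D_v f z) z = G z by rewrite -GE.
rewrite FE GE; apply/eqP; rewrite -subr_eq0 -normr_le0; apply/ler_addgt0Pr => e e0.
rewrite add0r.
have e20 : 0 < e / 2 by rewrite divr_gt0.
have /nbhs_normP[r /= r0 rP] : \forall y \near x,
    [/\ derivable f y u, derivable f y v, derivable (fun z => 'D_u f z) y v &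
      derivable (fun z => 'D_v f z) y u] /\
    (`|F x - F y| < e / 2 /\ `|G x - G y| < e / 2).
  apply: filterI => //; apply: filterI.
    exact: ((cvgrPdist_lt _ _).1 cF _ e20).
  exact: ((cvgrPdist_lt _ _).1 cG _ e20).
have {}rP y : `|y - x| < r -> [/\ derivable f y u, derivable f y v,
    derivable (fun z => 'D_u f z) y v & derivable (fun z => 'D_v f z) y u] /\
    (`|F x - F y| < e / 2 /\ `|G x - G y| < e / 2).
  by move=> yr; apply: rP => /=; rewrite /ball_ /= distrC.
(* The summand 1 keeps the denominator positive when u = v = 0 and makes h (|u| + |v|) < r
   strict. *)
pose h := r / (`|u| + `|v| + 1).
have d0 : 0 < `|u| + `|v| + 1 by rewrite ltr_wpDl // addr_ge0.
have h0 : 0 < h by rewrite divr_gt0.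
have hr : h * (`|u| + `|v|) < r.
  by rewrite /h mulrAC ltr_pdivrMr // ltr_pM2l // ltrDl.
have near_x (s t : R) a b : `|a| + `|b| = `|u| + `|v| -> `|s| <= h -> `|t| <= h ->
    `|x + s *: a + t *: b - x| < r.
  move=> ab sh th; rewrite -(addrA x) [x + _]addrC addrK (le_lt_trans _ hr) //.
  rewrite (le_trans (ler_normD _ _)) // !normrZ -ab mulrDr.
  by rewrite lerD // ler_wpM2r.
have [|s [t [sh th eq1]]] := @second_difference f u v x r h (ltW h0) hr.
  by move=> y /rP[[]].
have [||s' [t' [sh' th' eq2]]] := @second_difference f v u x r h (ltW h0).
- by rewrite addrC.
- by move=> y /rP[[]].
(* Both values, multiplied by h * h, are the same second difference of f. *)
have FG : F (x + s *: u + t *: v) = G (x + s' *: v + t' *: u).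
  have hh : h * h != 0 by rewrite mulf_neq0 // gt_eqF.
  rewrite FE in eq1; rewrite GE in eq2; apply: (mulfI hh).
  rewrite -[LHS]eq1 -[RHS]eq2 [x + h *: v + _]addrAC !opprB.
  by rewrite addrACA [RHS]addrACA [- f (x + h *: u) + _]addrC.
have [_ [Fe _]] := rP _ (near_x s t u v erefl sh th).
have [_ [_ Ge]] := rP _ (near_x s' t' v u (addrC _ _) sh' th').
rewrite -(subrKA (F (x + s *: u + t *: v))) {2}FG -[X in _ + X]opprB.
by rewrite (le_trans (ler_normB _ _)) // [leRHS]splitr lerD // ltW.
Qed.

End Directional.

(** * Chain rule from continuous partial derivatives *)

Section ChainRule.
Variable R : realType.

Lemma continuous_mxP (T : topologicalType) (m n : nat) (c : T -> 'M[R]_(m, n)) x :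
  (forall i j, {for x, continuous (fun y => c y i j)}) -> {for x, continuous c}.
Proof.
move=> cc; apply/cvgrPdist_lt => /= e e0; near=> y.
rewrite /Num.Def.normr /= mx_normrE; apply: bigmax_lt => //= ij _.
rewrite !mxE; move: ij; near: y; apply: filter_forall => -[i j] /=.
exact: ((cvgrPdist_lt _ _).1 (cc i j)).
Unshelve. all: by end_near. Qed.

Lemma le_coord_norm (m n : nat) (M : 'M[R]_(m, n)) i j : `|M i j| <= `|M|.
Proof.
by rewrite [leRHS]/Num.Def.normr /= mx_normrE; exact: (le_bigmax _ _ (i, j)).
Qed.

Variable q : nat.
Implicit Types (g : 'rV[R]_q -> R) (y w : 'rV[R]_q).

(** These rows are the vertices of the path from 0 to w that follows one coordinate axis at a
    time. *)
Definition row_trunc (k : nat) w : 'rV[R]_q :=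
  \row_j (if (j < k)%N then w 0 j else 0).

Lemma row_trunc0 w : row_trunc 0 w = 0.
Proof. by apply/rowP => j; rewrite !mxE. Qed.

Lemma row_trunc_full w : row_trunc q w = w.
Proof. by apply/rowP => j; rewrite !mxE ltn_ord. Qed.

Lemma row_truncS (k : 'I_q) w :
  row_trunc k.+1 w = row_trunc k w + w 0 k *: delta_mx 0 k.
Proof.
apply/rowP => j; rewrite !mxE eqxx /= ltnS leq_eqVlt.
have [->|jk] := eqVneq j k; first by rewrite eqxx ltnn add0r mulr1.
by rewrite -val_eqE in jk; rewrite (negPf jk) mulr0 addr0.
Qed.

Lemma norm_row_trunc (k : 'I_q) w (c : R) : `|c| <= `|w 0 k| ->
  `|row_trunc k w + c *: delta_mx 0 k| <= `|w|.
Proof.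
move=> cw; rewrite [leLHS]/Num.Def.normr /= mx_normrE.
apply: bigmax_le => //= -[i j] _ /=; rewrite !mxE (ord1 i) eqxx /=.
have [->|jk] := eqVneq j k.
  by rewrite ltnn add0r mulr1 (le_trans cw) // le_coord_norm.
rewrite mulr0 addr0; case: ifP => _; first exact: le_coord_norm.
by rewrite normr0.
Qed.

(** The difference quotient of g over the k-th edge of the path from y to y + w. On a degenerate
    edge the value is the partial derivative at y, the limit of the slopes as w tends to 0. *)
Definition slope_row g y (k : 'I_q) w : R :=
  if w 0 k == 0 then 'D_(delta_mx 0 k) g y
  else (g (y + row_trunc k.+1 w) - g (y + row_trunc k w)) / w 0 k.

Lemma slope_rowE g y w :
  g (y + w) - g y = \sum_k w 0 k * slope_row g y k w.
Proof.
have -> : g (y + w) - g y = g (y + row_trunc q w) - g (y + row_trunc 0 w).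
  by rewrite row_trunc_full row_trunc0 addr0.
rewrite -(telescope_sumr (fun k => g (y + row_trunc k w))) // big_mkord.
apply: eq_bigr => k _; rewrite /slope_row; case: eqVneq => [wk0|wk0].
  by rewrite row_truncS wk0 scale0r addr0 subrr mul0r.
by rewrite mulrC divfK.
Qed.

(** By the mean value theorem the slope is a partial derivative at a point of the k-th edge, and in
    the sup norm this point is at distance at most |w| from y. *)
Lemma cvg_slope_row g y (k : 'I_q) :
  (\forall z \near y, derivable g z (delta_mx 0 k)) ->
  {for y, continuous (fun z => 'D_(delta_mx 0 k) g z)} ->
  forall e : R, 0 < e -> exists2 r : R, 0 < r & forall w, `|w| < r ->
    `|'D_(delta_mx 0 k) g y - slope_row g y k w| < e.
Proof.
move=> dg cg; move=> e e0.
have /nbhs_normP[r /= r0 rP] : \forall z \near y, derivable g z (delta_mx 0 k) /\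
    `|'D_(delta_mx 0 k) g y - 'D_(delta_mx 0 k) g z| < e.
  by apply: filterI => //; exact: ((cvgrPdist_lt _ _).1 cg _ e0).
exists r => // w wr.
have {}rP (c : R) : `|c| <= `|w 0 k| ->
    derivable g (y + row_trunc k w + c *: delta_mx 0 k) (delta_mx 0 k) /\
    `|'D_(delta_mx 0 k) g y -
      'D_(delta_mx 0 k) g (y + row_trunc k w + c *: delta_mx 0 k)| < e.
  move=> cw; apply: rP => /=; rewrite -addrA opprD addNKr normrN.
  exact: le_lt_trans (norm_row_trunc cw) wr.
rewrite /slope_row; case: eqVneq => [_|wk0]; first by rewrite subrr normr0.
rewrite row_truncS addrA.
have [|c cw ->] := @MVT_line _ _ g (y + row_trunc k w) (delta_mx 0 k) (w 0 k).
  by move=> c /rP[].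
by rewrite mulfK //; exact: (rP _ cw).2.
Qed.

(** The difference quotient of g o c splits into slopes of g times difference quotients of the
    coordinates of c, and each factor converges. *)
Lemma is_derive_comp_row (E : normedModType R) (c : E -> 'rV[R]_q) g (x v : E) :
  (forall k, derivable (fun t => c t 0 k) x v) ->
  (forall k, \forall z \near c x, derivable g z (delta_mx 0 k)) ->
  (forall k, {for c x, continuous (fun z => 'D_(delta_mx 0 k) g z)}) ->
  is_derive x v (fun t => g (c t))
    (\sum_k 'D_(delta_mx 0 k) g (c x) * 'D_v (fun t => c t 0 k) x).
Proof.
move=> dc dg cg.
(* Derivability of the coordinates in direction v yields continuity of c along the line through
   x. *)
have cc : {for 0, continuous (fun h : R => c (h *: v + x))}.
  apply/differentiable_continuous/derivable1_diffP/(derivable1P _ _ _).1.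
  by apply/derivable_mxP => i j; rewrite (ord1 i); exact: dc.
suff lim : (fun h : R => h^-1 *: (((fun t => g (c t)) \o shift x) (h *: v) - g (c x)))
    @ 0^' --> \sum_k 'D_(delta_mx 0 k) g (c x) * 'D_v (fun t => c t 0 k) x.
  by apply: DeriveDef; [apply/cvg_ex; eexists; exact: lim|exact/cvg_lim].
have -> : (fun h : R => h^-1 *: (((fun t => g (c t)) \o shift x) (h *: v) - g (c x)))
  = (fun h : R => \sum_k slope_row g (c x) k (c (h *: v + x) - c x) *
      (h^-1 *: (c (h *: v + x) 0 k - c x 0 k))).
  apply/funext => h /=.
  have := slope_rowE g (c x) (c (h *: v + x) - c x).
  rewrite [c x + _]addrC subrK => ->; rewrite scaler_sumr; apply: eq_bigr => k _.
  by rewrite !mxE mulrC scalerAr.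
apply: cvg_big => [|k _]; first exact: add_continuous.
apply: cvgM; last exact: dc.
apply/cvgrPdist_lt => e /(cvg_slope_row (dg k) (cg k))[r r0 rP].
apply: nbhs_dnbhs; have /cvgrPdist_lt := cc; rewrite scale0r add0r => /(_ _ r0).
by apply: filterS => h hr; apply: rP; rewrite distrC.
Qed.
End ChainRule.

(* Sealed copy of [partial]: with the transparent constant, unifying two distinct
   iterated partial derivatives unfolds limits and does not terminate in practice. *)
HB.lock Definition pderiv (R : realType) (p : nat) (i : 'I_p) (f : 'rV[R]_p -> R) :
  'rV[R]_p -> R := partial i f.

(** * Stability of the classes C^n on an open set *)

Section ClassC.
Variable R : realType.
Implicit Types (n p q : nat).

Lemma pderivE p (i : 'I_p) (f : 'rV[R]_p -> R) : pderiv i f = partial i f.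
Proof. by rewrite pderiv.unlock. Qed.

Lemma classC_intro n p (U : set 'rV[R]_p) f :
  (forall x, U x -> {for x, continuous f}) ->
  (forall i x, U x -> derivable f x (delta_mx 0 i)) ->
  (forall i, classC n U (pderiv i f)) -> classC n.+1 U f.
Proof.
move=> cf df Cf; split=> // i; split; first exact: df.
by rewrite -pderivE.
Qed.

Lemma open_near (p : nat) (U : set 'rV[R]_p) (T : set 'rV[R]_p) x :
  open U -> U x -> (forall y, U y -> T y) -> nbhs x T.
Proof. by move=> oU Ux UT; apply: filterS UT (open_nbhs_nbhs (conj oU Ux)). Qed.

Lemma eq_pderiv p (U : set 'rV[R]_p) (f h : 'rV[R]_p -> R) i x :
  open U -> (forall y, U y -> f y = h y) -> U x -> pderiv i f x = pderiv i h x.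
Proof. by move=> oU fh Ux; rewrite !pderivE; apply: near_eq_derive; exact: open_near oU Ux fh. Qed.

Lemma eq_continuous_open p (U : set 'rV[R]_p) (f h : 'rV[R]_p -> R) x :
  open U -> (forall y, U y -> f y = h y) -> U x ->
  {for x, continuous f} -> {for x, continuous h}.
Proof.
move=> oU fh Ux cf; change (h @ x --> h x); rewrite -(fh _ Ux); apply: cvg_trans cf.
exact: (@near_eq_cvg _ _ (nbhs x) _ f h (open_near oU Ux fh)).
Qed.

Lemma classC_continuous n p (U : set 'rV[R]_p) f x :
  classC n U f -> U x -> {for x, continuous f}.
Proof. by case: n => [|n] [cf _]; exact: cf. Qed.

Lemma classC_derivable n p (U : set 'rV[R]_p) f i x :
  classC n.+1 U f -> U x -> derivable f x (delta_mx 0 i).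
Proof. by move=> [_ df]; exact: (df i).1. Qed.

Lemma classC_pderiv n p (U : set 'rV[R]_p) f i :
  classC n.+1 U f -> classC n U (pderiv i f).
Proof. by rewrite pderivE => -[_ df]; exact: (df i).2. Qed.

Lemma classCW n p (U : set 'rV[R]_p) f : classC n.+1 U f -> classC n U f.
Proof.
elim: n f => [|n IHn] f [cf df]; first by split.
by split=> // i; split; [exact: (df i).1|apply: IHn; exact: (df i).2].
Qed.

Lemma classC_le m n p (U : set 'rV[R]_p) f :
  (m <= n)%N -> classC n U f -> classC m U f.
Proof.
move=> /subnKC <-; elim: (n - m)%N => [|k IHk]; first by rewrite addn0.
by rewrite addnS => /classCW.
Qed.

Lemma eq_classC n p (U : set 'rV[R]_p) f h : open U -> (forall y, U y -> f y = h y) ->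
  classC n U f -> classC n U h.
Proof.
move=> oU; elim: n f h => [|n IHn] f h fh Cf.
  by split=> // x Ux; exact: (eq_continuous_open oU fh Ux (classC_continuous Cf Ux)).
apply: classC_intro => [x Ux|i x Ux|i].
- exact: (eq_continuous_open oU fh Ux (classC_continuous Cf Ux)).
- exact: near_eq_derivable (open_near oU Ux fh) (classC_derivable Cf Ux).
- by apply: IHn (classC_pderiv i Cf) => y Uy; exact: (eq_pderiv i oU fh Uy).
Qed.

Lemma pderiv_cst p (c : R) (i : 'I_p) : pderiv i (fun _ => c) = fun _ => 0.
Proof. by apply/funext => x; rewrite pderivE /partial derive_cst. Qed.

Lemma classC_cst n p (U : set 'rV[R]_p) (c : R) : classC n U (fun _ => c).
Proof.
elim: n c => [|n IHn] c; first by split=> // x _; exact: cst_continuous.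
apply: classC_intro => [x _|i x _|i]; first exact: cst_continuous.
  exact: derivable_cst.
by rewrite pderiv_cst.
Qed.

Lemma pderivD n p (U : set 'rV[R]_p) f h i x : classC n.+1 U f -> classC n.+1 U h ->
  U x -> pderiv i (fun y => f y + h y) x = pderiv i f x + pderiv i h x.
Proof.
rewrite !pderivE => Cf Ch Ux.
by apply: deriveD; [exact: classC_derivable Cf Ux|exact: classC_derivable Ch Ux].
Qed.

Lemma pderivM n p (U : set 'rV[R]_p) f h i x : classC n.+1 U f -> classC n.+1 U h ->
  U x -> pderiv i (fun y => f y * h y) x = pderiv i f x * h x + f x * pderiv i h x.
Proof.
move=> Cf Ch Ux; rewrite addrC [pderiv i f x * _]mulrC !pderivE.
by apply: deriveM; [exact: classC_derivable Cf Ux|exact: classC_derivable Ch Ux].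
Qed.

Lemma classCD n p (U : set 'rV[R]_p) f h : open U ->
  classC n U f -> classC n U h -> classC n U (fun x => f x + h x).
Proof.
move=> oU; elim: n f h => [|n IHn] f h Cf Ch.
  split=> // x Ux.
  by apply: continuousD; [exact: classC_continuous Cf Ux|exact: classC_continuous Ch Ux].
apply: classC_intro => [x Ux|i x Ux|i].
- by apply: continuousD; [exact: classC_continuous Cf Ux|exact: classC_continuous Ch Ux].
- by apply: derivableD; [exact: classC_derivable Cf Ux|exact: classC_derivable Ch Ux].
apply: eq_classC oU _ (IHn _ _ (classC_pderiv i Cf) (classC_pderiv i Ch)).
by move=> y Uy; rewrite (pderivD i Cf Ch Uy).
Qed.

Lemma classCM n p (U : set 'rV[R]_p) f h : open U ->
  classC n U f -> classC n U h -> classC n U (fun x => f x * h x).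
Proof.
move=> oU; elim: n f h => [|n IHn] f h Cf Ch.
  split=> // x Ux.
  by apply: continuousM; [exact: classC_continuous Cf Ux|exact: classC_continuous Ch Ux].
apply: classC_intro => [x Ux|i x Ux|i].
- by apply: continuousM; [exact: classC_continuous Cf Ux|exact: classC_continuous Ch Ux].
- by apply: derivableM; [exact: classC_derivable Cf Ux|exact: classC_derivable Ch Ux].
have Cfh := IHn _ _ (classC_pderiv i Cf) (classCW Ch).
have Chf := IHn _ _ (classCW Cf) (classC_pderiv i Ch).
apply: eq_classC oU _ (classCD oU Cfh Chf).
by move=> y Uy; rewrite (pderivM i Cf Ch Uy).
Qed.

Lemma classC_sum n p (U : set 'rV[R]_p) (I : Type) (r : seq I) (P : pred I)
    (F : I -> 'rV[R]_p -> R) : open U -> (forall i, classC n U (F i)) ->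
  classC n U (fun x => \sum_(i <- r | P i) F i x).
Proof.
move=> oU CF; elim: r => [|i r IHr].
  by under eq_fun do rewrite big_nil; exact: classC_cst.
under eq_fun do rewrite big_cons.
by case: (P i) => //; exact: classCD.
Qed.

Lemma classC_prod n p (U : set 'rV[R]_p) (I : Type) (r : seq I) (P : pred I)
    (F : I -> 'rV[R]_p -> R) : open U -> (forall i, classC n U (F i)) ->
  classC n U (fun x => \prod_(i <- r | P i) F i x).
Proof.
move=> oU CF; elim: r => [|i r IHr].
  by under eq_fun do rewrite big_nil; exact: classC_cst.
under eq_fun do rewrite big_cons.
by case: (P i) => //; exact: classCM.
Qed.

Lemma classCV n p (U : set 'rV[R]_p) f : open U -> classC n U f ->
  (forall x, U x -> f x != 0) -> classC n U (fun x => (f x)^-1).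
Proof.
move=> oU Cf f0; elim: n f Cf f0 => [|n IHn] f Cf f0.
  by split=> // x Ux; apply: continuousV; [exact: f0|exact: classC_continuous Cf Ux].
apply: classC_intro => [x Ux|i x Ux|i].
- by apply: continuousV; [exact: f0|exact: classC_continuous Cf Ux].
- by apply: derivableV; [exact: f0|exact: classC_derivable Cf Ux].
have CV := IHn _ (classCW Cf) f0.
have := classCM oU (classC_cst n U (-1)) (classCM oU (classCM oU CV CV) (classC_pderiv i Cf)).
apply: eq_classC oU _ => y Uy.
rewrite !pderivE /partial deriveV; [|exact: f0|exact: classC_derivable Cf Uy].
by rewrite mulN1r -exprVn expr2 scaleNr.
Qed.

Lemma is_derive_comp_pderiv n p q (U : set 'rV[R]_p) (V : set 'rV[R]_q) (f : 'rV[R]_p -> 'rV[R]_q)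
    g i x : open V -> (forall k, classC n.+1 U (fun y => f y 0 k)) ->
  (forall y, U y -> V (f y)) -> classC n.+1 V g -> U x ->
  is_derive x (delta_mx 0 i) (fun y => g (f y))
    (\sum_k pderiv k g (f x) * pderiv i (fun y => f y 0 k) x).
Proof.
move=> oV Cf fV Cg Ux; under eq_bigr do rewrite !pderivE.
apply: is_derive_comp_row => k.
- exact: classC_derivable (Cf k) Ux.
- by apply: open_near oV (fV x Ux) _ => z Vz; exact: classC_derivable Cg Vz.
- by have := classC_continuous (classC_pderiv k Cg) (fV x Ux); rewrite pderivE.
Qed.

(** Induction on n for all g: the chain rule writes a partial derivative of g o f as a sum of
    products whose first factor is again a composite with f, one class lower. *)
Lemma classC_comp n p q (U : set 'rV[R]_p) (V : set 'rV[R]_q) (f : 'rV[R]_p -> 'rV[R]_q)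
    g : open U -> open V -> (forall k, classC n U (fun y => f y 0 k)) ->
  (forall y, U y -> V (f y)) -> classC n V g -> classC n U (fun y => g (f y)).
Proof.
move=> oU oV; elim: n g => [|n IHn] g Cf fV Cg.
  split=> // x Ux; apply: continuous_comp; last exact: classC_continuous Cg (fV _ Ux).
  by apply: continuous_mxP => i j; rewrite (ord1 i); exact: classC_continuous (Cf j) Ux.
apply: classC_intro => [x Ux|i x Ux|i].
- apply: continuous_comp; last exact: classC_continuous Cg (fV _ Ux).
  by apply: continuous_mxP => i j; rewrite (ord1 i); exact: classC_continuous (Cf j) Ux.
- by have [] := is_derive_comp_pderiv i oV Cf fV Cg Ux.
suff : classC n U (fun x => \sum_k pderiv k g (f x) * pderiv i (fun y => f y 0 k) x).
  apply: eq_classC oU _ => x Ux.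
  by rewrite pderivE; have [_ <-] := is_derive_comp_pderiv i oV Cf fV Cg Ux.
apply: classC_sum => // k; apply: classCM => //; last exact: classC_pderiv.
apply: IHn => //; last exact: classC_pderiv.
by move=> j; exact: classCW.
Qed.

Lemma pderiv_swap n p (U : set 'rV[R]_p) f i j x : open U -> classC n.+2 U f -> U x ->
  pderiv i (pderiv j f) x = pderiv j (pderiv i f) x.
Proof.
move=> oU Cf Ux; have := classC_continuous (classC_pderiv i (classC_pderiv j Cf)) Ux.
have := classC_continuous (classC_pderiv j (classC_pderiv i Cf)) Ux.
have := classC_pderiv j Cf; have := classC_pderiv i Cf; rewrite !pderivE.
move=> Ci Cj cji cij; apply: derive_swap; [|exact: cij|exact: cji].
refine (open_near oU Ux _) => y Uy; split.
- exact: classC_derivable Cf Uy.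
- exact: classC_derivable Cf Uy.
- exact: classC_derivable Cj Uy.
- exact: classC_derivable Ci Uy.
Qed.

End ClassC.

(** * Iterated partial derivatives indexed by words and by multi-indices *)

Section WordDerivatives.
Variables (R : realType) (p : nat) (U : set 'rV[R]_p).
Hypothesis oU : open U.
Implicit Types (f h : 'rV[R]_p -> R) (w : seq 'I_p).

Definition wpartial w f : 'rV[R]_p -> R := foldr (@pderiv R p) f w.

Lemma classC_wpartial n w f : classC (size w + n) U f -> classC n U (wpartial w f).
Proof.
elim: w n => [|i w IHw] n; first by rewrite add0n.
rewrite [size _]/= addSnnS => /IHw.
exact: classC_pderiv.
Qed.

Lemma wpartial_cat w1 w2 f : wpartial (w1 ++ w2) f = wpartial w1 (wpartial w2 f).
Proof. by rewrite /wpartial foldr_cat. Qed.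

(** The letter i passes the letters of [w1] one at a time; each exchange is Schwarz's theorem for an
    inner derivative that is still of class C^2. *)
Lemma wpartial_front w1 i w2 f x : classC (size (w1 ++ i :: w2)) U f -> U x ->
  wpartial (w1 ++ i :: w2) f x = wpartial (i :: w1 ++ w2) f x.
Proof.
elim: w1 x => [|j w1 IHw] x //= Cf Ux.
have -> : pderiv j (wpartial (w1 ++ i :: w2) f) x =
          pderiv j (wpartial (i :: w1 ++ w2) f) x.
  by apply: (eq_pderiv j oU _ Ux) => y; apply: IHw; exact: classCW.
apply: (@pderiv_swap _ 0 _ U) => //; apply: classC_wpartial.
by move: Cf; rewrite !size_cat /= addn2 addnS.
Qed.

Lemma perm_wpartial w1 w2 f x : perm_eq w1 w2 -> classC (size w1) U f -> U x ->
  wpartial w1 f x = wpartial w2 f x.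
Proof.
elim: w1 w2 x => [|i w1 IHw] w2 x; first by rewrite perm_sym => /perm_nilP ->.
move=> w12 Cf Ux; have iw2 : i \in w2 by rewrite -(perm_mem w12) mem_head.
case/splitPr: w2 / iw2 w12 => a b; rewrite perm_sym.
rewrite -cat1s perm_catCA /= perm_cons perm_sym => wab.
rewrite (@wpartial_front a i b) //.
  apply: (eq_pderiv i oU _ Ux) => y; apply: IHw => //; exact: classCW.
by rewrite size_cat /= addnS -size_cat -(perm_size wab).
Qed.

Definition mword (alpha : 'I_p -> nat) : seq 'I_p :=
  flatten [seq nseq (alpha i) i | i <- enum 'I_p].

Lemma mpartialE alpha f : mpartial alpha f = wpartial (mword alpha) f.
Proof.
have pE : @partial R p = @pderiv R p by rewrite pderiv.unlock.
rewrite /mpartial /mword pE; elim: (enum 'I_p) => //= i s ->.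
rewrite wpartial_cat; elim: (alpha i) => //= k IHk.
by rewrite IHk.
Qed.

Lemma count_mword alpha i : count_mem i (mword alpha) = alpha i.
Proof.
rewrite /mword count_flatten -map_comp sumnE big_map big_enum /=.
rewrite (bigD1 i) //= count_nseq /= eqxx mul1n big1 ?addn0 // => j ji.
by rewrite count_nseq /= (negPf ji) mul0n.
Qed.

Lemma size_mword alpha : size (mword alpha) = \sum_i alpha i.
Proof.
rewrite /mword size_flatten /shape -map_comp sumnE big_map big_enum /=.
by apply: eq_bigr => i _; rewrite size_nseq.
Qed.

(** The word of alpha and the word of beta followed by i have the same letter counts, hence are
    permutations of each other. *)
Lemma mpartial_shift (alpha beta : 'I_p -> nat) i f x :
  (forall j, alpha j = beta j + (j == i))%N ->
  classC (\sum_j alpha j) U f -> U x ->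
  mpartial alpha f x = mpartial beta (pderiv i f) x.
Proof.
move=> ab Cf Ux; rewrite !mpartialE -[pderiv i f]/(wpartial [:: i] f) -wpartial_cat.
apply: perm_wpartial => //; last by rewrite size_mword.
apply/allP => j _ /=; rewrite count_cat !count_mword ab /= addn0.
by rewrite [i == j]eq_sym.
Qed.

End WordDerivatives.

(** * Taylor sums with increments in a commutative algebra *)

Section TaylorSum.
Variables (R : realType) (S : comNzRingType) (iota : {rmorphism R -> S}).

Section Words.
Variables (p : nat) (K : 'I_p -> S).
Implicit Types (f h : 'rV[R]_p -> R) (x : 'rV[R]_p) (U : set 'rV[R]_p).

(* [dpow k] and [tay n] are the D_k and T_n of the proof sketch above. *)
Fixpoint dpow (k : nat) f x : S :=
  if k is k'.+1 then \sum_i K i * dpow k' (pderiv i f) x else iota (f x).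

Definition tay (n : nat) f x : S :=
  \sum_(k < n.+1) iota (k`!)%:R^-1 * dpow k f x.

Lemma eq_dpow U k f h x : open U -> (forall y, U y -> f y = h y) -> U x ->
  dpow k f x = dpow k h x.
Proof.
move=> oU; elim: k f h => [|k IHk] f h fh Ux /=; first by rewrite fh.
apply: eq_bigr => i _; congr (_ * _); apply: IHk => // y Uy.
exact: (eq_pderiv i oU fh Uy).
Qed.

Lemma eq_tay U n f h x : open U -> (forall y, U y -> f y = h y) -> U x ->
  tay n f x = tay n h x.
Proof.
by move=> oU fh Ux; apply: eq_bigr => k _; rewrite (eq_dpow k oU fh Ux).
Qed.

Lemma dpowD U k f h x : open U -> classC k U f -> classC k U h -> U x ->
  dpow k (fun y => f y + h y) x = dpow k f x + dpow k h x.
Proof.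
move=> oU; elim: k f h => [|k IHk] f h Cf Ch Ux /=; first by rewrite rmorphD.
rewrite -big_split; apply: eq_bigr => i _ /=.
rewrite -mulrDr -IHk //; try exact: classC_pderiv.
congr (_ * _); apply: (eq_dpow k oU _ Ux) => y Uy; exact: pderivD Cf Ch Uy.
Qed.

Lemma tayD U n f h x : open U -> classC n U f -> classC n U h -> U x ->
  tay n (fun y => f y + h y) x = tay n f x + tay n h x.
Proof.
move=> oU Cf Ch Ux; rewrite /tay -big_split; apply: eq_bigr => k _ /=.
have kn : (k <= n)%N by rewrite -ltnS.
rewrite -mulrDr; congr (_ * _).
exact: (dpowD oU (classC_le kn Cf) (classC_le kn Ch) Ux).
Qed.

Lemma dpow_cst k (c : R) x : dpow k.+1 (fun _ => c) x = 0.
Proof.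
elim: k c => [|k IHk] c /=; apply: big1 => i _; rewrite pderiv_cst ?rmorph0 ?mulr0 //.
by rewrite [X in _ * X]IHk mulr0.
Qed.

Lemma tay_cst n (c : R) x : tay n (fun _ => c) x = iota c.
Proof.
rewrite /tay big_ord_recl big1 ?addr0 => [|k _]; last by rewrite dpow_cst mulr0.
by rewrite /= fact0 invr1 rmorph1 mul1r.
Qed.

Lemma tay_sum U n (I : Type) (r : seq I) (F : I -> 'rV[R]_p -> R) x : open U ->
  (forall i, classC n U (F i)) -> U x ->
  tay n (fun y => \sum_(i <- r) F i y) x = \sum_(i <- r) tay n (F i) x.
Proof.
move=> oU CF Ux; elim: r => [|i r IHr].
  under eq_fun do rewrite big_nil.
  by rewrite big_nil tay_cst rmorph0.
rewrite big_cons -IHr -(tayD oU (CF i) (classC_sum r xpredT oU CF) Ux).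
by under eq_fun do rewrite big_cons.
Qed.

Lemma tay_recr n f x :
  tay n.+1 f x = tay n f x + iota (n.+1`!)%:R^-1 * dpow n.+1 f x.
Proof. by rewrite /tay big_ord_recr. Qed.

End Words.
End TaylorSum.

Lemma rmorph_dpow (R : realType) (S S' : comNzRingType) (iota : {rmorphism R -> S})
  (iota' : {rmorphism R -> S'}) (phi : {rmorphism S -> S'}) p
  (K : 'I_p -> S) (K' : 'I_p -> S') k f x :
  (forall r, phi (iota r) = iota' r) -> (forall i, phi (K i) = K' i) ->
  phi (dpow iota K k f x) = dpow iota' K' k f x.
Proof.
move=> phi_iota phiK; elim: k f => [|k IHk] f /=; first exact: phi_iota.
by rewrite rmorph_sum; apply: eq_bigr => i _; rewrite rmorphM IHk phiK.
Qed.

(** Applied to evaluation at t = 1, this carries Taylor sums over A[t] to Taylor sums over A. *)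
Lemma rmorph_tay (R : realType) (S S' : comNzRingType) (iota : {rmorphism R -> S})
  (iota' : {rmorphism R -> S'}) (phi : {rmorphism S -> S'}) p
  (K : 'I_p -> S) (K' : 'I_p -> S') n f x :
  (forall r, phi (iota r) = iota' r) -> (forall i, phi (K i) = K' i) ->
  phi (tay iota K n f x) = tay iota' K' n f x.
Proof.
move=> phi_iota phiK; rewrite rmorph_sum; apply: eq_bigr => k _.
by rewrite rmorphM phi_iota; congr (_ * _); exact: rmorph_dpow.
Qed.

(** * Product and chain rules for Taylor sums modulo powers of t *)

Section Truncation.
Variables (R : realType) (A : comAlgType R).
Implicit Types (P Q : {poly A}).

(** Congruence modulo t^n, encoded as an equality so that [esym] and [etrans] apply to it. *)
Definition eq_trunc (n : nat) P Q : Prop := take_poly n P = take_poly n Q.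

Lemma eq_truncP n P Q :
  eq_trunc n P Q <-> (forall k, (k < n)%N -> P`_k = Q`_k).
Proof.
split=> [PQ k kn|PQ]; last first.
  by apply/polyP => k; rewrite !coef_take_poly; case: ifP => // /PQ.
by have /polyP/(_ k) := PQ; rewrite !coef_take_poly kn.
Qed.

Lemma eq_truncW m n P Q : (m <= n)%N -> eq_trunc n P Q -> eq_trunc m P Q.
Proof.
move=> mn /eq_truncP PQ; apply/eq_truncP => k km; apply: PQ.
exact: leq_trans mn.
Qed.

Lemma eq_truncD n P P' Q Q' : eq_trunc n P P' -> eq_trunc n Q Q' ->
  eq_trunc n (P + Q) (P' + Q').
Proof. by rewrite /eq_trunc !take_polyD => -> ->. Qed.

Lemma eq_truncM n P P' Q Q' : eq_trunc n P P' -> eq_trunc n Q Q' ->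
  eq_trunc n (P * Q) (P' * Q').
Proof.
move=> /eq_truncP PP /eq_truncP QQ; apply/eq_truncP => k kn.
rewrite !coefM; apply: eq_bigr => i _.
by rewrite PP ?QQ //; apply: leq_ltn_trans kn; rewrite ?leq_subr // -ltnS.
Qed.

Lemma eq_trunc_sum n (I : Type) (r : seq I) (F G : I -> {poly A}) :
  (forall i, eq_trunc n (F i) (G i)) ->
  eq_trunc n (\sum_(i <- r) F i) (\sum_(i <- r) G i).
Proof.
move=> FG; elim: r => [|i r IHr]; first by rewrite !big_nil.
by rewrite !big_cons; exact: eq_truncD.
Qed.

Lemma mulrn_algI k : injective (fun a : A => a *+ k.+1).
Proof.
move=> a b /= ab; apply: (@scalerI R A k.+1%:R); first by rewrite pnatr_eq0.
by rewrite !scaler_nat.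
Qed.

Lemma eq_trunc_deriv n P Q : eq_trunc n.+1 P Q -> eq_trunc n P^`() Q^`().
Proof.
by move=> /eq_truncP PQ; apply/eq_truncP => k kn; rewrite !coef_deriv PQ.
Qed.

(** Formal integration: k + 1 is invertible in a real algebra, so the derivative determines all
    coefficients but the constant one. Both inductions below gain their order of t here. *)
Lemma eq_trunc_deriv_inv n P Q : P`_0 = Q`_0 -> eq_trunc n P^`() Q^`() ->
  eq_trunc n.+1 P Q.
Proof.
move=> PQ0 /eq_truncP PQ; apply/eq_truncP => -[|k] // kn.
by apply: (@mulrn_algI k); have := PQ k kn; rewrite !coef_deriv.
Qed.

Lemma deriv_bigsum (I : Type) (r : seq I) (F : I -> {poly A}) :
  (\sum_(i <- r) F i)^`() = \sum_(i <- r) (F i)^`().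
Proof. exact: raddf_sum. Qed.

Definition poly_alg : {rmorphism R -> {poly A}} := polyC \o in_alg A.

Lemma poly_algE r : poly_alg r = (r%:A)%:P. Proof. by []. Qed.

Section Increment.
Variables (p : nat) (K : 'I_p -> {poly A}).
Hypothesis K0 : forall i, (K i)`_0 = 0.
Implicit Types (f h : 'rV[R]_p -> R) (U : set 'rV[R]_p).
Local Notation dpowK := (dpow poly_alg K).
Local Notation tayK := (tay poly_alg K).

(** D_k f is a combination of products of k increments, each divisible by t. *)
Lemma coef_dpow k m f x : (m < k)%N -> (dpowK k f x)`_m = 0.
Proof.
elim: k m f => //= k IHk m f mk; rewrite coef_sum; apply: big1 => i _.
rewrite coefM; apply: big1 => -[[|j] jm] _ /=; first by rewrite K0 mul0r.
rewrite IHk ?mulr0 // ltn_subLR // addSn ltnS.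
exact: leq_trans (mk : (m <= k)%N) (leq_addl j k).
Qed.

Lemma tay_trunc n f x : eq_trunc n.+1 (tayK n.+1 f x) (tayK n f x).
Proof.
apply/eq_truncP => k kn; rewrite tay_recr coefD poly_algE coefCM coef_dpow // mulr0 addr0.
by [].
Qed.

Lemma coef0_tay n f x : (tayK n f x)`_0 = (f x)%:A.
Proof.
rewrite /tay coef_sum big_ord_recl big1 ?addr0 => [|k _].
  by rewrite fact0 invr1 rmorph1 mul1r /= coefC.
by rewrite poly_algE coefCM coef_dpow ?mulr0.
Qed.

Lemma deriv_poly_alg r : (poly_alg r)^`() = 0.
Proof. exact: derivC. Qed.

(** Since partial derivatives commute, the k + 1 increments play symmetric roles, and
    differentiating any one of them gives the same contribution. *)
Lemma deriv_dpow U k f x : open U -> classC k.+1 U f -> U x ->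
  (dpowK k.+1 f x)^`() = (\sum_j (K j)^`() * dpowK k (pderiv j f) x) *+ k.+1.
Proof.
move=> oU; elim: k f => [|k IHk] f Cf Ux.
  rewrite /= deriv_bigsum mulr1n; apply: eq_bigr => i _.
  by rewrite derivM derivC mulr0 addr0.
have swap i j : dpowK k (pderiv j (pderiv i f)) x = dpowK k (pderiv i (pderiv j f)) x.
  apply: (eq_dpow _ _ k oU _ Ux) => y Uy.
  have le2k : (2 <= k.+2)%N by [].
  exact: (pderiv_swap _ _ oU (classC_le le2k Cf) Uy).
rewrite [dpowK k.+2 f x]/= deriv_bigsum.
under eq_bigr => i _.
  rewrite derivM -[\sum_j _]/(dpowK k.+1 (pderiv i f) x).
  rewrite (IHk _ (classC_pderiv i Cf) Ux).
  over.
(* One contribution comes from the outermost increment, the other k + 1 from the induction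
   hypothesis. *)
rewrite big_split /= [in RHS]mulrS; congr (_ + _).
under eq_bigr => i _ do rewrite mulrnAr mulr_sumr -sumrMnl.
rewrite exchange_big /= -sumrMnl; apply: eq_bigr => j _.
rewrite mulr_sumr -sumrMnl; apply: eq_bigr => i _.
by rewrite mulrCA swap.
Qed.

(** The term of order 0 is constant in t, and the factor k + 1 from [deriv_dpow] turns 1 / (k + 1)!
    into 1 / k!. *)
Lemma deriv_tay U n f x : open U -> classC n.+1 U f -> U x ->
  (tayK n.+1 f x)^`() = \sum_j (K j)^`() * tayK n (pderiv j f) x.
Proof.
move=> oU Cf Ux; rewrite /tay deriv_bigsum big_ord_recl /= derivM derivC mul0r add0r.
rewrite derivC mulr0 add0r.
under [RHS]eq_bigr do rewrite mulr_sumr.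
rewrite exchange_big /=; apply: eq_bigr => k _.
rewrite -[bump 0 k]/(k.+1) derivM derivC mul0r add0r.
have kn : (k.+1 <= n.+1)%N by [].
have fE : poly_alg (k.+1)`!%:R^-1 *+ k.+1 = poly_alg (k`!)%:R^-1.
  rewrite -(rmorphMn poly_alg); apply: (congr1 poly_alg).
  by rewrite -[LHS]mulr_natr factS natrM invfM mulrAC mulVf ?mul1r //.
rewrite -[\sum_i _]/(dpowK k.+1 f x) (deriv_dpow oU (classC_le kn Cf) Ux).
rewrite mulrnAr -mulrnAl mulr_sumr; apply: eq_bigr => j _; rewrite mulrCA.
congr (_ * (_ * _)).
exact: fE.
Qed.

(** Constant terms agree. After [deriv_tay] and the product rule, the t-derivatives are compared
    summand by summand: the induction hypothesis applies to (d_j f, h) and (f, d_j h), because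
    T_(n+1) and T_n agree modulo t^(n+1). *)
Lemma tayM U n f h x : open U -> classC n U f -> classC n U h -> U x ->
  eq_trunc n.+1 (tayK n (fun y => f y * h y) x) (tayK n f x * tayK n h x).
Proof.
move=> oU; elim: n f h => [|n IHn] f h Cf Ch Ux.
  apply/eq_truncP => -[|//] _; rewrite coefM big_ord_recl big_ord0 addr0 !coef0_tay.
  by rewrite -in_algE rmorphM.
apply: eq_trunc_deriv_inv.
  rewrite coefM big_ord_recl big_ord0 addr0 !coef0_tay.
  by rewrite -in_algE rmorphM.
rewrite derivM (deriv_tay oU (classCM oU Cf Ch) Ux) (deriv_tay oU Cf Ux) (deriv_tay oU Ch Ux).
rewrite mulr_suml mulr_sumr -big_split; apply: eq_trunc_sum => j /=.
rewrite mulrCA -mulrA -mulrDr; apply: eq_truncM => //.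
have Cfj := classC_pderiv j Cf; have Chj := classC_pderiv j Ch.
rewrite (eq_tay _ _ n oU (fun y Uy => pderivM j Cf Ch Uy) Ux).
rewrite (tayD _ _ oU (classCM oU Cfj (classCW Ch)) (classCM oU (classCW Cf) Chj) Ux).
apply: eq_truncD.
  apply: etrans (IHn _ _ Cfj (classCW Ch) Ux) _.
  by apply: eq_truncM => //; apply: esym; exact: tay_trunc.
apply: etrans (IHn _ _ (classCW Cf) Chj Ux) _.
by apply: eq_truncM => //; apply: esym; exact: tay_trunc.
Qed.

End Increment.

(** L is prescribed only modulo t^(n+1), so that one fixed L serves all orders in the induction. *)
Lemma tay_comp p q (U : set 'rV[R]_p) (V : set 'rV[R]_q) n
    (K : 'I_p -> {poly A}) (L : 'I_q -> {poly A})
    (f : 'rV[R]_p -> 'rV[R]_q) (g : 'rV[R]_q -> R) x :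
  open U -> open V -> (forall i, (K i)`_0 = 0) ->
  (forall k, classC n U (fun y => f y 0 k)) -> (forall y, U y -> V (f y)) ->
  classC n V g -> U x ->
  (forall j, eq_trunc n.+1 (L j)
     (tay poly_alg K n (fun y => f y 0 j) x - poly_alg (f x 0 j))) ->
  eq_trunc n.+1 (tay poly_alg K n (fun y => g (f y)) x) (tay poly_alg L n g (f x)).
Proof.
move=> oU oV K0 Cf fV Cg Ux LE.
have L0 i : (L i)`_0 = 0.
  by have /eq_truncP -> // := LE i; rewrite coefB coef0_tay //= coefC subrr.
elim: n g Cf Cg LE => [|n IHn] g Cf Cg LE.
  by apply/eq_truncP => -[|//] _; rewrite !coef0_tay.
apply: eq_trunc_deriv_inv; first by rewrite !coef0_tay.
have Cgf := classC_comp oU oV Cf fV Cg.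
rewrite (deriv_tay K oU Cgf Ux) (deriv_tay L oV Cg (fV _ Ux)).
have Cgk k := classC_pderiv k Cg.
have Cfk k i := classC_pderiv i (Cf k).
have Cf' k := classCW (Cf k).
have Cgkf k := classC_comp oU oV Cf' fV (Cgk k).
have E i : tay poly_alg K n (pderiv i (fun y => g (f y))) x =
    \sum_k tay poly_alg K n (fun y => pderiv k g (f y) * pderiv i (fun y => f y 0 k) y) x.
  rewrite -(tay_sum _ _ _ oU _ Ux).
    apply: (eq_tay _ _ n oU _ Ux) => y Uy.
    by rewrite pderivE; have [_ <-] := is_derive_comp_pderiv i oV Cf fV Cg Uy.
  by move=> k; exact: classCM oU (Cgkf k) (Cfk k i).
under eq_bigr do rewrite E mulr_sumr.
rewrite exchange_big /=; apply: eq_trunc_sum => k.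
(* The derivative of L_k is congruent to that of T_(n+1) f_k, so both sides become sums over i and k
   with the common factor K_i'. *)
have := @eq_trunc_deriv _ _ _ (LE k); rewrite derivB deriv_poly_alg subr0.
rewrite (deriv_tay K oU (Cf k) Ux) => LK.
apply: esym; apply: etrans (eq_truncM LK erefl) _.
rewrite mulr_suml; apply: eq_trunc_sum => i; rewrite -mulrA; apply: eq_truncM => //.
apply: esym; apply: etrans (tayM K0 oU (Cgkf k) (Cfk k i) Ux) _.
rewrite mulrC; apply: eq_truncM => //; apply: IHn => // j.
apply: etrans (eq_truncW (leqnSn _) (LE j)) _.
by apply: eq_truncD => //; exact: tay_trunc.
Qed.

End Truncation.

(** * Powers of the maximal ideal and the Rees algebra *)

Section WeilFiltration.
Variables (R : realType) (A : weilType R).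
Implicit Types (a b h : A) (P Q : {poly A}).

Lemma weil_max_ideal : alg_ideal (weil_max A).
Proof. by have [] := @weil_maximal _ A. Qed.

Lemma weil_maxD a b : weil_max A a -> weil_max A b -> weil_max A (a + b).
Proof. by have [_ + _] := weil_max_ideal; apply. Qed.

Lemma weil_maxMl a b : weil_max A b -> weil_max A (a * b).
Proof. by have [_ _ +] := weil_max_ideal; apply. Qed.

Lemma weil_maxB a b : weil_max A a -> weil_max A b -> weil_max A (a - b).
Proof. by move=> ma mb; rewrite -mulN1r; apply: weil_maxD => //; exact: weil_maxMl. Qed.

Lemma weil_piP a : weil_max A (a - (weil_pi a)%:A).
Proof.
have [r [h [mh ->]]] := weil_decomp a.
rewrite /weil_pi; case: xgetP => [s -> //|/(_ r) /=].
by rewrite [r%:A + h]addrC addrK.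
Qed.

Lemma weil_pi_unique (r : R) a : weil_max A (a - r%:A) -> weil_pi a = r.
Proof.
move=> mr; apply/eqP; rewrite -subr_eq0; apply/eqP; apply: (@weil_direct _ A).
have := weil_maxB mr (weil_piP a).
by rewrite opprB addrC subrKA -scalerBl.
Qed.

(** Membership in the ideal power m^k, with m^0 = A. Generating it inductively allows sums of
    products to be treated by rule induction. *)
Inductive weil_pow : nat -> A -> Prop :=
| WeilPow0 a : weil_pow 0 a
| WeilPowZ k : weil_pow k 0
| WeilPowD k a b : weil_pow k a -> weil_pow k b -> weil_pow k (a + b)
| WeilPowM k h a : weil_max A h -> weil_pow k a -> weil_pow k.+1 (h * a).

Lemma weil_powMl k a b : weil_pow k b -> weil_pow k (a * b).
Proof.
elim=> [c|l|l c d _ Hc _ Hd|l h c mh _ Hc].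
- exact: WeilPow0.
- by rewrite mulr0; exact: WeilPowZ.
- by rewrite mulrDr; exact: WeilPowD.
- by rewrite mulrCA; exact: WeilPowM.
Qed.

Lemma weil_pow_mul k l a b :
  weil_pow k a -> weil_pow l b -> weil_pow (k + l) (a * b).
Proof.
move=> ka lb; elim: ka => {k a} [c|k|k c d _ Hc _ Hd|k h c mh _ Hc].
- exact: weil_powMl.
- by rewrite mul0r; exact: WeilPowZ.
- by rewrite mulrDl; exact: WeilPowD.
- by rewrite -mulrA addSn; exact: WeilPowM.
Qed.

Lemma weil_pow_sum k (I : Type) (r : seq I) (F : I -> A) :
  (forall i, weil_pow k (F i)) -> weil_pow k (\sum_(i <- r) F i).
Proof.
by move=> kF; apply: big_ind => //; [exact: WeilPowZ|exact: WeilPowD].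
Qed.

Lemma weil_prod_eq0 (s : seq A) : (weil_index A < size s)%N ->
  (forall h, h \in s -> weil_max A h) -> \prod_(h <- s) h = 0.
Proof.
move=> Ns ms; rewrite -(cat_take_drop (weil_index A).+1 s) big_cat /=.
rewrite (big_nth 0) size_takel // big_mkord (@weil_nilp _ A) ?mul0r // => i.
by apply: ms; rewrite nth_take // mem_nth // (leq_trans (ltn_ord i)).
Qed.

Lemma weil_pow_eq0 k a : (weil_index A < k)%N -> weil_pow k a -> a = 0.
Proof.
(* Nilpotency speaks of products of elements of m, so the factors peeled off from a are accumulated
   in s. *)
suff main : weil_pow k a -> forall s : seq A, (weil_index A < k + size s)%N ->
    (forall h, h \in s -> weil_max A h) -> a * \prod_(h <- s) h = 0.
  move=> Nk /main/(_ [::]); rewrite addn0 big_nil mulr1; exact.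
elim=> {k a} [c|k|k c d _ Hc _ Hd|k h c mh _ Hc] s Ns ms.
- by rewrite weil_prod_eq0 ?mulr0.
- by rewrite mul0r.
- by rewrite mulrDl Hc ?Hd ?addr0.
- rewrite [h * c]mulrC -mulrA; have := Hc (h :: s); rewrite big_cons; apply.
    by rewrite addnS -addSn.
  by move=> h'; rewrite inE => /predU1P[->|/ms].
Qed.

(* The Rees algebra of the m-adic filtration, inside A[t]. *)
Definition rees P : Prop := forall k, weil_pow k P`_k.

Lemma reesC a : rees a%:P.
Proof.
by move=> [|k]; rewrite coefC /=; [exact: WeilPow0|exact: WeilPowZ].
Qed.

Lemma reesD P Q : rees P -> rees Q -> rees (P + Q).
Proof. by move=> rP rQ k; rewrite coefD; exact: WeilPowD. Qed.

Lemma reesM P Q : rees P -> rees Q -> rees (P * Q).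
Proof.
move=> rP rQ k; rewrite coefM; apply: weil_pow_sum => i.
by have := weil_pow_mul (rP i) (rQ (k - i)%N); rewrite subnKC // -ltnS.
Qed.

Lemma rees_sum (I : Type) (r : seq I) (F : I -> {poly A}) :
  (forall i, rees (F i)) -> rees (\sum_(i <- r) F i).
Proof.
move=> rF; apply: big_ind => //; last exact: reesD.
by rewrite -polyC0; exact: reesC.
Qed.

Lemma rees_scaleX h : weil_max A h -> rees (h *: 'X).
Proof.
move=> mh [|[|k]]; rewrite coefZ coefX /=; first exact: WeilPow0.
  by apply: WeilPowM => //; exact: WeilPow0.
by rewrite mulr0; exact: WeilPowZ.
Qed.

Lemma rees_tay p (K : 'I_p -> {poly A}) n f x : (forall i, rees (K i)) ->
  rees (tay (poly_alg A) K n f x).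
Proof.
move=> rK; apply: rees_sum => k; apply: reesM; first exact: reesC.
elim: (val k) f => [|l IHl] f /=; first exact: reesC.
by apply: rees_sum => i; exact: reesM.
Qed.

(** For k > N the coefficient of t^k lies in m^k = 0, so a congruence modulo t^(N+1) leaves nothing
    undetermined. *)
Lemma rees_eq P Q : rees P -> rees Q -> eq_trunc (weil_index A).+1 P Q -> P = Q.
Proof.
move=> rP rQ /eq_truncP PQ; apply/polyP => k; have [/PQ //|Nk] := ltnP k (weil_index A).+1.
by rewrite (weil_pow_eq0 Nk (rP k)) (weil_pow_eq0 Nk (rQ k)).
Qed.

End WeilFiltration.

(** * The multi-index Taylor polynomial as a Taylor sum *)

Section MultiIndex.
Variables (R : realType) (A : comAlgType R) (p N : nat) (H : 'I_p -> A).
Variables (U : set 'rV[R]_p) (x : 'rV[R]_p).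
Hypotheses (oU : open U) (Ux : U x).
Implicit Types (f : 'rV[R]_p -> R) (alpha beta : {ffun 'I_p -> 'I_N.+1}).

Definition taylor_term f (alpha : 'I_p -> nat) : A :=
  ((\prod_i (alpha i)`!)%:R^-1 * mpartial alpha f x) *: \prod_i H i ^+ alpha i.

(** With alpha = beta + e_i: alpha_i / alpha! = 1 / beta!, H^alpha = H_i H^beta, and one derivative
    d_i moves inside. *)
Lemma taylor_term_shift f (alpha beta : 'I_p -> nat) i :
  (forall j, alpha j = beta j + (j == i))%N -> classC (\sum_j alpha j) U f ->
  (alpha i)%:R *: taylor_term f alpha = H i * taylor_term (pderiv i f) beta.
Proof.
move=> ab Cf; rewrite /taylor_term (mpartial_shift oU ab Cf Ux).
have ai : alpha i = (beta i).+1 by rewrite ab eqxx addn1.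
have aj j : j != i -> alpha j = beta j by move=> ji; rewrite ab (negPf ji) addn0.
have -> : (\prod_j (alpha j)`! = (beta i).+1 * \prod_j (beta j)`!)%N.
  rewrite (bigD1 i) //= [in RHS](bigD1 i) //= ai factS -mulnA; congr (_ * (_ * _))%N.
  by apply: eq_bigr => j /aj ->.
have -> : \prod_j H j ^+ alpha j = H i * \prod_j H j ^+ beta j.
  rewrite (bigD1 i) //= [in RHS](bigD1 i) //= ai exprS -mulrA; congr (_ * (_ * _)).
  by apply: eq_bigr => j /aj ->.
rewrite ai -[RHS]scalerAr scalerA; congr (_ *: _); rewrite natrM invfM !mulrA.
by rewrite mulfV ?mul1r // pnatr_eq0.
Qed.

(** Exponents are bounded by N; when [beta i] is N, [inord] overflows to 0, whence the bound
    [beta i < N] in the lemmas about it. *)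
Definition multi_incr i beta : {ffun 'I_p -> 'I_N.+1} :=
  [ffun j => inord (beta j + (j == i))].

Definition multi_decr i alpha : {ffun 'I_p -> 'I_N.+1} :=
  [ffun j => inord (alpha j - (j == i))].

Lemma multi_incrE i beta j : (beta i < N)%N ->
  multi_incr i beta j = (beta j + (j == i))%N :> nat.
Proof.
move=> bi; rewrite ffunE inordK //; have [->|ji] := eqVneq j i; rewrite ?addn1 ?addn0 //.
Qed.

Lemma multi_decrE i alpha j : multi_decr i alpha j = (alpha j - (j == i))%N :> nat.
Proof. by rewrite ffunE inordK // (leq_ltn_trans (leq_subr _ _)). Qed.

Lemma multi_decrK i alpha : (0 < alpha i)%N -> multi_incr i (multi_decr i alpha) = alpha.
Proof.
move=> ai; apply/ffunP => j; apply: val_inj.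
rewrite /= multi_incrE multi_decrE ?eqxx ?subn1.
  by have [->|ji] := eqVneq j i; rewrite ?subn0 ?addn0 // subnK.
by rewrite -ltnS prednK.
Qed.

Lemma multi_incrK i beta : (beta i < N)%N -> multi_decr i (multi_incr i beta) = beta.
Proof.
by move=> bi; apply/ffunP => j; apply: val_inj; rewrite /= multi_decrE multi_incrE ?addnK.
Qed.

Lemma sum_multi_incr i beta : (beta i < N)%N ->
  (\sum_j multi_incr i beta j = (\sum_j beta j).+1)%N.
Proof.
move=> bi; under eq_bigr do rewrite multi_incrE //.
rewrite big_split /= -[RHS]addn1; congr (_ + _)%N.
by rewrite (bigD1 i) //= eqxx big1 // => j /negPf ->.
Qed.

Definition taylor_hom k f : A :=
  \sum_(alpha : {ffun 'I_p -> 'I_N.+1} | (\sum_i alpha i == k)%N)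
    taylor_term f (fun i => alpha i).

(** Euler's identity: k + 1 is the sum of the alpha_i when |alpha| = k + 1. For each i the terms
    with alpha_i > 0 are then reindexed by alpha = beta + e_i. *)
Lemma taylor_homS k f : (k < N)%N -> classC k.+1 U f ->
  k.+1%:R *: taylor_hom k.+1 f = \sum_i H i * taylor_hom k (pderiv i f).
Proof.
move=> kN Cf.
have -> : k.+1%:R *: taylor_hom k.+1 f = \sum_i
    \sum_(alpha : {ffun 'I_p -> 'I_N.+1} | (\sum_j alpha j == k.+1)%N)
      (alpha i)%:R *: taylor_term f (fun i => alpha i).
  rewrite exchange_big scaler_sumr; apply: eq_bigr => alpha /eqP <-.
  by rewrite -scaler_suml natr_sum.
apply: eq_bigr => i _; rewrite mulr_sumr.
rewrite (bigID (fun alpha : {ffun 'I_p -> 'I_N.+1} => (0 < alpha i)%N)) /=.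
rewrite [X in _ + X]big1 ?addr0 => [|alpha /andP[_]]; last first.
  by rewrite -eqn0Ngt => /eqP ->; rewrite scale0r.
rewrite (reindex_onto (multi_incr i) (multi_decr i)) => [|alpha /andP[_]]; last first.
  exact: multi_decrK.
have ltN beta : (\sum_j beta j == k)%N -> (beta i < N)%N.
  move=> /eqP bk; apply: leq_ltn_trans kN; rewrite -bk (bigD1 i) //=; exact: leq_addr.
apply: eq_big => [beta|beta /andP[/andP[/eqP hk hi] /eqP hK]].
  have [bi|] := ltnP (beta i) N.
    by rewrite sum_multi_incr // eqSS multi_incrK // eqxx multi_incrE // eqxx addn1 !andbT.
  (* If [beta i] is N, both conditions fail: |beta| >= N > k on one side, and the overflow of
     [inord] to 0 contradicts positivity on the other. *)
  move=> Nb; have -> : (\sum_j beta j == k)%N = false.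
    by apply/negP => /ltN; rewrite ltnNge Nb.
  have -> : (0 < multi_incr i beta i)%N = false; last by rewrite andbF.
  have biN : (beta i).+1 = N.+1.
    by congr S; apply/eqP; rewrite eqn_leq Nb -ltnS ltn_ord.
  rewrite ffunE eqxx addn1 biN /inord /insubd insubF //=.
  by rewrite ltnn.
have bi : (beta i < N)%N.
  by rewrite -hK multi_decrE eqxx subn1 -ltnS prednK.
apply: taylor_term_shift => [j|]; first by rewrite multi_incrE.
by rewrite hk.
Qed.

Lemma taylor_homE k f : (k <= N)%N -> classC k U f ->
  taylor_hom k f = (k`!)%:R^-1 *: dpow (in_alg A) H k f x.
Proof.
elim: k f => [|k IHk] f kN Cf.
  rewrite /taylor_hom (big_pred1 [ffun _ => ord0]) => [|alpha]; last first.
    rewrite sum_nat_eq0; apply/forallP/eqP => [a0|-> i]; last by rewrite ffunE.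
    by apply/ffunP => i; apply: val_inj; rewrite ffunE /=; apply/eqP; exact: a0.
  rewrite fact0 invr1 scale1r /taylor_term.
  rewrite big1 => [|i _]; last by rewrite ffunE.
  rewrite big1 => [|i _]; last by rewrite ffunE expr0.
  rewrite invr1 mul1r mpartialE /=; congr (_ *: _).
  have -> // : mword (fun i : 'I_p => [ffun=> (ord0 : 'I_N.+1)] i) = [::].
  by apply/nilP; rewrite /nilp size_mword big1 // => i _; rewrite ffunE.
have := taylor_homS kN Cf.
have k0 : k.+1%:R != 0 :> R by rewrite pnatr_eq0.
move/(congr1 ( *:%R (k.+1%:R^-1 : R))); rewrite scalerA mulVf // scale1r => ->.
rewrite (eq_bigr (fun i => (k`!)%:R^-1 *: (H i * dpow (in_alg A) H k (pderiv i f) x))).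
  by rewrite -scaler_sumr scalerA -invfM -natrM.
move=> i _; rewrite IHk ?scalerAr //; last exact: classC_pderiv.
exact: ltnW.
Qed.

Lemma taylor_sumE f : classC N U f ->
  \sum_(alpha : {ffun 'I_p -> 'I_N.+1} | (\sum_i alpha i <= N)%N)
    taylor_term f (fun i => alpha i) = tay (in_alg A) H N f x.
Proof.
(* The sum is grouped by total degree; [inord] is faithful here because |alpha| <= N. *)
move=> Cf; rewrite (partition_big
  (fun alpha : {ffun 'I_p -> 'I_N.+1} => inord (\sum_i alpha i) : 'I_N.+1) xpredT) //=.
apply: eq_bigr => k _; have kN : (k <= N)%N by rewrite -ltnS.
rewrite mulr_algl -(taylor_homE kN (classC_le kN Cf)); apply: eq_bigl => alpha.
have [aN|Na] /= := leqP (\sum_i alpha i)%N N.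
  by rewrite -val_eqE /= inordK.
by apply/esym/negbTE; rewrite neq_ltn (leq_ltn_trans kN Na) orbT.
Qed.

End MultiIndex.

(** * The prolongation as the value at t = 1 of a Taylor sum over A[t] *)

Section WeilTaylor.
Variables (R : realType) (A : weilType R).
Local Notation N := (weil_index A).

Definition weil_incr p (X : 'rV[A]_p) (i : 'I_p) : A := X 0 i - (weil_pi (X 0 i))%:A.

Lemma weilJ_tay p (U : set 'rV[R]_p) f (X : 'rV[A]_p) : open U -> classC N U f ->
  weil_dom U X -> weilJ f X = tay (in_alg A) (weil_incr X) N f (map_mx (@weil_pi R A) X).
Proof.
move=> oU Cf UX; rewrite -(taylor_sumE (weil_incr X) oU UX Cf).
apply: eq_bigr => alpha _; rewrite /taylor_term; congr (_ *: _).
by apply: eq_bigr => i _; rewrite /weil_incr !mxE.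
Qed.

Definition weil_line p (X : 'rV[A]_p) (i : 'I_p) : {poly A} := weil_incr X i *: 'X.

Lemma weil_line0 p (X : 'rV[A]_p) i : (weil_line X i)`_0 = 0.
Proof. by rewrite coefZ coefX mulr0. Qed.

Lemma rees_weil_line p (X : 'rV[A]_p) i : rees (weil_line X i).
Proof. by apply: rees_scaleX; exact: weil_piP. Qed.

Lemma tay_horner1 p (L : 'I_p -> {poly A}) (H : 'I_p -> A) n f x :
  (forall i, (L i).[1] = H i) ->
  (tay (poly_alg A) L n f x).[1] = tay (in_alg A) H n f x.
Proof.
move=> LH; apply: (@rmorph_tay _ _ _ (poly_alg A) (in_alg A) (horner_eval 1)) => //.
by move=> r; exact: (hornerC r%:A 1).
Qed.

Lemma weilJ_horner1 p (U : set 'rV[R]_p) f (X : 'rV[A]_p) : open U -> classC N U f ->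
  weil_dom U X ->
  weilJ f X = (tay (poly_alg A) (weil_line X) N f (map_mx (@weil_pi R A) X)).[1].
Proof.
move=> oU Cf UX; rewrite (weilJ_tay oU Cf UX) -(tay_horner1 (L := weil_line X)) // => i.
by rewrite hornerZ hornerX mulr1.
Qed.

End WeilTaylor.

(** * Algebraic rules and functoriality of the scalar prolongation *)

Section WeilMorphism.
Variables (R : realType) (A : weilType R).
Local Notation N := (weil_index A).
Implicit Types p q : nat.

Lemma eq_weilJ p (U : set 'rV[R]_p) f h (X : 'rV[A]_p) : open U -> classC N U f ->
  (forall y, U y -> f y = h y) -> weil_dom U X -> weilJ f X = weilJ h X.
Proof.
move=> oU Cf fh UX; rewrite (weilJ_tay oU Cf UX) (weilJ_tay oU (eq_classC oU fh Cf) UX).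
exact: (eq_tay _ _ _ oU fh UX).
Qed.

Lemma weilJ_cst p (c : R) (X : 'rV[A]_p) : weilJ (fun=> c) X = c%:A.
Proof.
by rewrite (weilJ_tay openT (classC_cst N setT c)) // tay_cst.
Qed.

Lemma weilJD p (U : set 'rV[R]_p) f h (X : 'rV[A]_p) : open U -> classC N U f ->
  classC N U h -> weil_dom U X -> weilJ (fun x => f x + h x) X = weilJ f X + weilJ h X.
Proof.
move=> oU Cf Ch UX; rewrite (weilJ_tay oU (classCD oU Cf Ch) UX).
by rewrite (weilJ_tay oU Cf UX) (weilJ_tay oU Ch UX); exact: (tayD _ _ oU Cf Ch UX).
Qed.

(** Both sides are values at t = 1 of Rees elements that [tayM] makes congruent modulo t^(N+1),
    hence equal. *)
Lemma weilJM p (U : set 'rV[R]_p) f h (X : 'rV[A]_p) : open U -> classC N U f ->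
  classC N U h -> weil_dom U X -> weilJ (fun x => f x * h x) X = weilJ f X * weilJ h X.
Proof.
move=> oU Cf Ch UX; rewrite (weilJ_horner1 oU (classCM oU Cf Ch) UX).
rewrite (weilJ_horner1 oU Cf UX) (weilJ_horner1 oU Ch UX) -hornerM.
congr (_.[1]); apply: rees_eq.
- by apply: rees_tay => i; exact: rees_weil_line.
- by apply: reesM; apply: rees_tay => i; exact: rees_weil_line.
- exact: (tayM (weil_line0 X) oU Cf Ch UX).
Qed.

Lemma weilJ_sum p (U : set 'rV[R]_p) (I : Type) (r : seq I) (F : I -> 'rV[R]_p -> R)
    (X : 'rV[A]_p) : open U -> (forall i, classC N U (F i)) -> weil_dom U X ->
  weilJ (fun x => \sum_(i <- r) F i x) X = \sum_(i <- r) weilJ (F i) X.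
Proof.
move=> oU CF UX; rewrite (weilJ_tay oU (classC_sum r xpredT oU CF) UX).
rewrite (tay_sum _ _ _ oU CF UX); apply: eq_bigr => i _.
by rewrite (weilJ_tay oU (CF i) UX).
Qed.

Lemma weilJV p (U : set 'rV[R]_p) f (X : 'rV[A]_p) : open U -> classC N U f ->
  (forall x, U x -> f x <> 0) -> weil_dom U X ->
  weilJ f X \is a GRing.unit /\ weilJ (fun x => (f x)^-1) X = (weilJ f X)^-1.
Proof.
move=> oU Cf f0 UX; have {}f0 x : U x -> f x != 0 by move=> /f0/eqP.
have CV := classCV oU Cf f0.
have J1 : weilJ f X * weilJ (fun x => (f x)^-1) X = 1.
  rewrite -(weilJM oU Cf CV UX) -[RHS]scale1r -(weilJ_cst 1 X).
  (* The product of f and 1 / f is known to be 1 on U only, so the locality of the prolongation is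
     used. *)
  by apply: eq_weilJ oU (classCM oU Cf CV) _ UX => y /f0 fy; rewrite mulfV.
have uf : weilJ f X \is a GRing.unit.
  by apply/unitrPr; exists (weilJ (fun x => (f x)^-1) X).
by split=> //; apply: (mulrI uf); rewrite J1 divrr.
Qed.

(** Every term of positive order contains an increment, which lies in m. *)
Lemma weil_pi_weilJ p (U : set 'rV[R]_p) f (X : 'rV[A]_p) : open U -> classC N U f ->
  weil_dom U X -> weil_pi (weilJ f X) = f (map_mx (@weil_pi R A) X).
Proof.
move=> oU Cf UX; apply: weil_pi_unique; rewrite (weilJ_tay oU Cf UX) /tay big_ord_recl.
rewrite fact0 invr1 rmorph1 mul1r /= addrC addKr.
have max_sum (I : Type) (r : seq I) (F : I -> A) :
    (forall i, weil_max A (F i)) -> weil_max A (\sum_(i <- r) F i).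
  move=> mF; apply: big_ind => //; [|exact: weil_maxD].
  by have [] := weil_max_ideal A.
apply: (max_sum) => k; apply: weil_maxMl; apply: max_sum => i; rewrite mulrC.
by apply: weil_maxMl; exact: weil_piP.
Qed.

Lemma weilJ_comp p q (U : set 'rV[R]_p) (V : set 'rV[R]_q) (f : 'rV[R]_p -> 'rV[R]_q) g
    (X : 'rV[A]_p) : open U -> open V -> (forall k, classC N U (fun y => f y 0 k)) ->
  (forall y, U y -> V (f y)) -> classC N V g -> weil_dom U X ->
  weilJ (fun x => g (f x)) X = weilJ g (weilJ_mx f X).
Proof.
move=> oU oV Cf fV Cg UX; set x := map_mx (@weil_pi R A) X.
have piY : map_mx (@weil_pi R A) (weilJ_mx f X) = f x.
  by apply/rowP => j; rewrite !mxE (weil_pi_weilJ oU).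
have VY : weil_dom V (weilJ_mx f X) by rewrite /weil_dom /= piY; exact: fV.
rewrite (weilJ_horner1 oU (classC_comp oU oV Cf fV Cg) UX) (weilJ_tay oV Cg VY) piY.
(* The increment of f lifted to A[t]. It may contain higher powers of t, but at t = 1 it is the
   nilpotent part of [weilJ_mx f X]. *)
pose L j := tay (poly_alg A) (weil_line X) N (fun y => f y 0 j) x - poly_alg A (f x 0 j).
rewrite -(@tay_horner1 _ _ _ L) => [|j]; last first.
  rewrite hornerD hornerN /weil_incr !mxE (weil_pi_weilJ oU) // -(weilJ_horner1 oU (Cf j) UX).
  by congr (_ - _); exact: (hornerC (f x 0 j)%:A 1).
have rL j : rees (L j).
  rewrite /L -rmorphN; apply: reesD; last exact: reesC.
  by apply: rees_tay => i; exact: rees_weil_line.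
congr (_.[1]); apply: rees_eq; try by apply: rees_tay => i; exact: rees_weil_line.
  exact: rees_tay.
exact: (tay_comp oU oV (weil_line0 X) Cf fV Cg UX).
Qed.

End WeilMorphism.

(** * Regularity of inverses of matrices and of algebra elements *)

Section SmoothInverse.
Variables (R : realType) (p n : nat) (U : set 'rV[R]_p).
Hypothesis oU : open U.

Lemma classC_det k (F : 'rV[R]_p -> 'M[R]_k) :
  classC_mx n U F -> classC n U (fun x => \det (F x)).
Proof.
move=> CF; apply: classC_sum => // s; apply: classCM => //; first exact: classC_cst.
exact: classC_prod.
Qed.

Lemma classC_invmx k (F : 'rV[R]_p -> 'M[R]_k) : classC_mx n U F ->
  (forall x, U x -> F x \in unitmx) -> classC_mx n U (fun x => invmx (F x)).
Proof.
move=> CF uF i j.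
have Cdet : classC n U (fun x => (\det (F x))^-1).
  apply: classCV => //; first exact: classC_det.
  by move=> x /uF; rewrite unitmxE unitfE.
suff Cadj : classC n U (fun x => \adj (F x) i j).
  apply: eq_classC oU _ (classCM oU Cdet Cadj) => x /uF uFx.
  by rewrite /invmx uFx [RHS]mxE.
under eq_fun do rewrite mxE.
apply: classCM => //; first exact: classC_cst.
apply: classC_det => a b; under eq_fun do rewrite !mxE.
exact: CF.
Qed.

Variables (B : falgType R) (m : nat) (e : m.-tuple B).
Hypothesis eB : basis_of fullv e.

Lemma coordK b : b = \sum_i coord e i b *: tnth e i.
Proof.
rewrite {1}(coord_basis eB (memvf b)); apply: eq_bigr => i _.
by rewrite (tnth_nth 0).
Qed.

Lemma coordM a b k : coord e k (a * b) =
  \sum_i \sum_j coord e k (tnth e i * tnth e j) * (coord e i a * coord e j b).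
Proof.
rewrite {1}(coordK a) mulr_suml linear_sum; apply: eq_bigr => i _ /=.
rewrite {1}(coordK b) mulr_sumr linear_sum; apply: eq_bigr => j _ /=.
by rewrite -scalerAl -scalerAr scalerA linearZ /= mulrC.
Qed.

(** Row j holds the coordinates of b e_j, so this matrix acts on coordinate rows from the right. *)
Definition left_mul_mx (b : B) : 'M[R]_m :=
  \matrix_(j, k) coord e k (b * tnth e j).

Lemma alg_coord_left_mul b c : alg_coord e c *m left_mul_mx b = alg_coord e (b * c).
Proof.
apply/rowP => k; rewrite !mxE {2}(coordK c) mulr_sumr linear_sum.
by apply: eq_bigr => j _ /=; rewrite !mxE -scalerAr linearZ.
Qed.

Lemma left_mul_mx_unit b : b \is a GRing.unit -> left_mul_mx b \in unitmx.
Proof.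
move=> ub; suff /mulmx1_unit[] : left_mul_mx b *m left_mul_mx b^-1 = 1%:M by [].
apply/row_matrixP => j.
have rowE' c : row j (left_mul_mx c) = alg_coord e (c * tnth e j).
  by apply/rowP => k; rewrite !mxE.
rewrite row_mul rowE' alg_coord_left_mul mulKr //; apply/rowP => k; rewrite !mxE.
by rewrite (tnth_nth 0) coord_free ?(basis_free eB).
Qed.

Lemma classC_alg_inv (f : 'rV[R]_p -> B) : classC_mx n U (fun x => alg_coord e (f x)) ->
  (forall x, U x -> f x \is a GRing.unit) ->
  classC_mx n U (fun x => alg_coord e (f x)^-1).
Proof.
move=> Cf uf i k; rewrite (ord1 i).
have Cfi j : classC n U (fun x => coord e j (f x)).
  by have := Cf 0 j; under eq_fun do rewrite mxE.
have CM : classC_mx n U (fun x => left_mul_mx (f x)).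
  move=> a b; under eq_fun do rewrite mxE coordM.
  apply: classC_sum => // c; apply: classC_sum => // d.
  apply: classCM => //; first exact: classC_cst.
  by apply: classCM => //; exact: classC_cst.
have := classC_invmx CM (fun x Ux => left_mul_mx_unit (uf x Ux)) => CI.
have : classC n U (fun x => \sum_j coord e j 1 * invmx (left_mul_mx (f x)) j k).
  by apply: classC_sum => // j; apply: classCM => //; exact: classC_cst.
apply: eq_classC oU _ => x /uf ufx.
(* The inverse solves the linear system b c = 1 in the coordinates of c. *)
have -> : alg_coord e (f x)^-1 = alg_coord e 1 *m invmx (left_mul_mx (f x)).
  rewrite -(mulrV ufx) -alg_coord_left_mul mulmxK //; exact: left_mul_mx_unit.
by rewrite mxE; apply: eq_bigr => j _; rewrite mxE.
Qed.

End SmoothInverse.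

(** * Scalar rules and their componentwise forms for vectors, matrices and algebras *)

Theorem theorem4p1 (R : realType) (A : weilType R) (p q : nat)
    (U : set 'rV[R]_p) (V : set 'rV[R]_q) (hU : open U) (hV : open V) :
  let N := weil_index A in
  (* (i) *)
  (forall f h : 'rV[R]_p -> R, classC N U f -> classC N U h ->
     forall X : 'rV[A]_p, weil_dom U X ->
       weilJ (fun x => f x + h x) X = weilJ f X + weilJ h X /\
       weilJ (fun x => f x * h x) X = weilJ f X * weilJ h X) /\
  (* (ii) *)
  (forall f : 'rV[R]_p -> R, classC N U f -> (forall x, U x -> f x <> 0) ->
     forall X : 'rV[A]_p, weil_dom U X ->
       weilJ f X \is a GRing.unit /\
       weilJ (fun x => (f x)^-1) X = (weilJ f X)^-1) /\
  (* (iii) *)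
  (forall (r : nat) (f : 'rV[R]_p -> 'rV[R]_q) (g : 'rV[R]_q -> 'rV[R]_r),
     classC_mx N U f -> (forall x, U x -> V (f x)) -> classC_mx N V g ->
     forall X : 'rV[A]_p, weil_dom U X ->
       weilJ_mx (fun x => g (f x)) X = weilJ_mx g (weilJ_mx f X)) /\
  (* vector- and matrix-valued maps: sums, entrywise products *)
  (forall (k l : nat) (f h : 'rV[R]_p -> 'M[R]_(k, l)),
     classC_mx N U f -> classC_mx N U h ->
     forall X : 'rV[A]_p, weil_dom U X ->
       weilJ_mx (fun x => f x + h x) X = weilJ_mx f X + weilJ_mx h X /\
       weilJ_mx (fun x => map2_mx *%R (f x) (h x)) X =
         map2_mx *%R (weilJ_mx f X) (weilJ_mx h X)) /\
  (* entrywise reciprocals *)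
  (forall (k l : nat) (f : 'rV[R]_p -> 'M[R]_(k, l)),
     classC_mx N U f -> (forall x, U x -> forall i j, f x i j <> 0) ->
     forall X : 'rV[A]_p, weil_dom U X ->
       (forall i j, weilJ_mx f X i j \is a GRing.unit) /\
       weilJ_mx (fun x => map_mx GRing.inv (f x)) X =
         map_mx GRing.inv (weilJ_mx f X)) /\
  (* matrix products *)
  (forall (k l m : nat) (f : 'rV[R]_p -> 'M[R]_(k, l))
          (h : 'rV[R]_p -> 'M[R]_(l, m)),
     classC_mx N U f -> classC_mx N U h ->
     forall X : 'rV[A]_p, weil_dom U X ->
       weilJ_mx (fun x => f x *m h x) X = weilJ_mx f X *m weilJ_mx h X) /\
  (* matrix inverses *)
  (forall (k : nat) (f : 'rV[R]_p -> 'M[R]_k),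
     classC_mx N U f -> (forall x, U x -> f x \in unitmx) ->
     forall X : 'rV[A]_p, weil_dom U X ->
       weilJ_mx f X \in unitmx /\
       weilJ_mx (fun x => invmx (f x)) X = invmx (weilJ_mx f X)) /\
  (* composition of matrix-valued maps, identifying k x l matrices with
     vectors of length k * l by mxvec *)
  (forall (k l m n : nat) (W : set 'rV[R]_(k * l))
          (f : 'rV[R]_p -> 'M[R]_(k, l)) (g : 'rV[R]_(k * l) -> 'M[R]_(m, n)),
     open W ->
     classC_mx N U f -> (forall x, U x -> W (mxvec (f x))) ->
     classC_mx N W g ->
     forall X : 'rV[A]_p, weil_dom U X ->
       weilJ_mx (fun x => g (mxvec (f x))) X =
         weilJ_mx g (mxvec (weilJ_mx f X))) /\
  (* maps into a finite-dimensional associative algebra B with basis e *)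
  (forall (B : falgType R) (n : nat) (e : n.-tuple B), basis_of fullv e ->
     (forall f h : 'rV[R]_p -> B,
        classC_mx N U (fun x => alg_coord e (f x)) ->
        classC_mx N U (fun x => alg_coord e (h x)) ->
        forall X : 'rV[A]_p, weil_dom U X ->
          weilJ_mx (fun x => alg_coord e (f x + h x)) X =
            weilJ_mx (fun x => alg_coord e (f x)) X +
            weilJ_mx (fun x => alg_coord e (h x)) X /\
          weilJ_mx (fun x => alg_coord e (f x * h x)) X =
            alg_mul e (weilJ_mx (fun x => alg_coord e (f x)) X)
                      (weilJ_mx (fun x => alg_coord e (h x)) X)) /\
     (forall f : 'rV[R]_p -> B,
        classC_mx N U (fun x => alg_coord e (f x)) ->
        (forall x, U x -> f x \is a GRing.unit) ->
        forall X : 'rV[A]_p, weil_dom U X ->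
          let Y := weilJ_mx (fun x => alg_coord e (f x)) X in
          let Z := weilJ_mx (fun x => alg_coord e (f x)^-1) X in
          alg_mul e Z Y = alg_one A e /\ alg_mul e Y Z = alg_one A e)).
Proof.
move=> N; split.
  move=> f h Cf Ch X UX; split; [exact: weilJD hU Cf Ch UX|exact: weilJM hU Cf Ch UX].
split; first by move=> f Cf f0 X UX; exact: weilJV hU Cf f0 UX.
split.
  move=> r f g Cf fV Cg X UX; apply/matrixP => i j; rewrite !mxE.
  exact: (weilJ_comp hU hV (Cf 0) fV (Cg i j) UX).
split.
  move=> k l f h Cf Ch X UX; split; apply/matrixP => i j; rewrite !mxE.
    rewrite -(weilJD hU (Cf i j) (Ch i j) UX).
    by congr weilJ; apply/funext => x; rewrite mxE.
  rewrite -(weilJM hU (Cf i j) (Ch i j) UX).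
  by congr weilJ; apply/funext => x; rewrite mxE.
split.
  move=> k l f Cf f0 X UX.
  have JV i j := weilJV hU (Cf i j) (fun x Ux => f0 x Ux i j) UX.
  split=> [i j|]; first by rewrite mxE; exact: (JV i j).1.
  apply/matrixP => i j; rewrite !mxE -(JV i j).2.
  by congr weilJ; apply/funext => x; rewrite mxE.
have mulJ (k l m : nat) (f : 'rV[R]_p -> 'M[R]_(k, l)) (h : 'rV[R]_p -> 'M[R]_(l, m)) :
    classC_mx N U f -> classC_mx N U h -> forall X : 'rV[A]_p, weil_dom U X ->
    weilJ_mx (fun x => f x *m h x) X = weilJ_mx f X *m weilJ_mx h X.
  move=> Cf Ch X UX; apply/matrixP => i j; rewrite !mxE.
  under eq_bigr do rewrite !mxE -(weilJM hU (Cf _ _) (Ch _ _) UX).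
  rewrite -(weilJ_sum _ hU _ UX) => [|a]; last exact: classCM.
  by congr weilJ; apply/funext => x; rewrite mxE.
split; first by [].
split.
  move=> k f Cf uf X UX; have CI := classC_invmx hU Cf uf.
  have J1 : weilJ_mx f X *m weilJ_mx (fun x => invmx (f x)) X = 1%:M.
    rewrite -mulJ //; apply/matrixP => i j; rewrite !mxE.
    (* The entry of the unit matrix over A is written as a real scalar, hence as the prolongation of
       a constant. *)
    rewrite -[RHS](_ : (i == j)%:R%:A = _); last by rewrite scaler_nat.
    rewrite -(weilJ_cst _ X); apply: (eq_weilJ hU _ _ UX) => [|y Uy]; last first.
      by rewrite mulmxV ?uf // mxE.
    under eq_fun do rewrite mxE.
    by apply: classC_sum => // a; exact: classCM.
  have [uJ _] := mulmx1_unit J1; split=> //.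
  by rewrite -[LHS](mulKmx uJ) J1 mulmx1.
split.
  move=> k l m n W f g oW Cf fW Cg X UX; apply/matrixP => i j; rewrite [LHS]mxE [RHS]mxE.
  rewrite (weilJ_comp hU oW _ fW (Cg i j) UX) => [|c].
    congr (weilJ _ _); apply/rowP => c; case/mxvec_indexP: c => a b.
    by rewrite mxvecE !mxE; congr weilJ; apply/funext => x; rewrite mxvecE.
  case/mxvec_indexP: c => a b; under eq_fun do rewrite mxvecE.
  exact: Cf.
move=> B n e eB.
have Cc (f : 'rV[R]_p -> B) : classC_mx N U (fun x => alg_coord e (f x)) ->
    forall k, classC N U (fun x => coord e k (f x)).
  by move=> Cf k; have := Cf 0 k; under eq_fun do rewrite mxE.
have Jc (f : 'rV[R]_p -> B) (X : 'rV[A]_p) k :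
    weilJ_mx (fun x => alg_coord e (f x)) X 0 k = weilJ (fun x => coord e k (f x)) X.
  by rewrite mxE; congr weilJ; apply/funext => x; rewrite mxE.
have mulB (f h : 'rV[R]_p -> B) : classC_mx N U (fun x => alg_coord e (f x)) ->
    classC_mx N U (fun x => alg_coord e (h x)) -> forall X : 'rV[A]_p, weil_dom U X ->
    weilJ_mx (fun x => alg_coord e (f x * h x)) X =
      alg_mul e (weilJ_mx (fun x => alg_coord e (f x)) X)
                (weilJ_mx (fun x => alg_coord e (h x)) X).
  move=> /Cc Cf /Cc Ch X UX; apply/rowP => k; rewrite Jc [RHS]mxE.
  under eq_fun do rewrite (coordM eB).
  have Cij i j : classC N U (fun x => coord e k (tnth e i * tnth e j) *
      (coord e i (f x) * coord e j (h x))).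
    by apply: classCM => //; [exact: classC_cst|exact: classCM].
  rewrite (weilJ_sum _ hU _ UX) => [|i]; last exact: classC_sum.
  apply: eq_bigr => i _; rewrite (weilJ_sum _ hU _ UX) //.
  apply: eq_bigr => j _; rewrite !Jc.
  rewrite (weilJM hU (classC_cst _ _ _) (classCM hU (Cf i) (Ch j)) UX) weilJ_cst.
  by rewrite mulr_algl (weilJM hU (Cf i) (Ch j) UX).
split.
  move=> f h Cf Ch X UX; split; last exact: mulB.
  apply/rowP => k; rewrite [RHS]mxE !Jc -(weilJD hU (Cc _ Cf k) (Cc _ Ch k) UX).
  by congr weilJ; apply/funext => x; rewrite linearD.
move=> f Cf uf X UX Y Z; have CV := classC_alg_inv hU eB Cf uf.
have J1 (h : 'rV[R]_p -> B) : (forall x, U x -> h x = 1) ->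
    weilJ_mx (fun x => alg_coord e (h x)) X = alg_one A e.
  move=> h1; apply/rowP => k; rewrite Jc mxE -(weilJ_cst _ X).
  apply/esym; apply: (eq_weilJ hU (classC_cst _ _ _) _ UX) => y /h1 ->.
  by [].
(* B may be noncommutative, so the two products are treated separately; each is the prolongation of
   a map equal to 1 on U. *)
rewrite /Y /Z -!mulB //; split; apply: J1 => x /uf ufx; [exact: mulVr|exact: mulrV].
Qed.
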